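(* Let $(A_n)_{n\ge 0}$ and $(Q_n)_{n\ge 0}$ be sequences of algebras over an integral domain $R$ satisfying axioms (1)–(12) listed in the context (with branching diagram $\Gamma$). Let $K$ be a field that is an $R$-module. Let $n_0$ be the smallest value of $n$ such that the trace $\mathrm{tr}$ on $A_n^K$ is degenerate, with $n_0=\infty$ if $\mathrm{tr}$ is non-degenerate on $A_n^K$ for all $n$. Let $n_1+1$ be the smallest value of $n$ such that $Q_n^K$ fails to be semisimple, with $n_1=\infty$ if $Q_n^K$ is semisimple for all $n$. Then $A_k^K$ is split semisimple for all $k\le m=\min\{n_0,n_1\}$. Moreover, the branching diagram for the sequence of algebras $(A_k^K)_{k\le m}$ is $\tilde\Gamma$ (truncated at level $m$).
   Context: **Branching diagrams.** A (multiplicity-free) abstract branching diagram $\Gamma$ is a graph with vertex set $\coprod_{i\ge 0}\Gamma_i$ such that $\Gamma_0$ is a singleton and every $\Gamma_i$ is finite; vertices $v\in\Gamma_i$, $w\in\Gamma_j$ are adjacent only if $|i-j|=1$, and adjacent vertices are joined by a unique edge; every $v\in\Gamma_i$ with $i\ge1$ is adjacent to at least one vertex of $\Gamma_{i-1}$. Write $|v|=i$ if $v\in\Gamma_i$, and $v\nearrow w$ if $v\in\Gamma_i$ is adjacent to $w\in\Gamma_{i+1}$. The diagram $\tilde\Gamma$ obtained from $\Gamma$ by reflections has level-$n$ vertices $\tilde\Gamma_n=\{(v,n): v\in\Gamma_k,\ k\le n,\ n-k \text{ even}\}$, and $(v,n)\nearrow(w,n+1)$ iff either $|w|=|v|+1$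 and $v\nearrow w$ in $\Gamma$, or $|w|=|v|-1$ and $w\nearrow v$ in $\Gamma$. For a sequence $B_0\to B_1\to\cdots$ of unital homomorphisms of finite dimensional split semisimple algebras over a field, the branching diagram has as level-$i$ vertices the simple components of $B_i$ (equivalently simple $B_i$-modules), the number of edges between a component of $B_{i+1}$ and one of $B_i$ being the multiplicity of the simple $B_i$-module in the restriction of the simple $B_{i+1}$-module. **Cellular algebras.** An algebra involution is an anti-automorphism $*$ with $(a^* )^*=a$. A unital algebra $A$ over an integral domain $R$ is cellular if it has an algebra involution $*$, a partially ordered set $(\Lambda,\ge)$, a set $\mathcal T(\lambda)$ for each $\lambda\in\Lambda$, and an $R$-basis $\{c^\lambda_{s,t}:\lambda\in\Lambda,\ s,t\in\mathcal T(\lambda)\}$ such that, with $A^{>\lambda}$ (resp. $A^{\ge\lambda}$) the span of the $c^\mu_{s,t}$ with $\mu>\lambda$ (resp. $\mu\ge\lambda$): for $a\in A$, $s\in\mathcal T(\lambda)$ there are $r^s_v(a)\in R$ with $a c^\lambda_{s,t}\equiv\sum_v r^s_v(a)c^\lambda_{v,t}\bmod A^{>\lambda}$ for all $t$; and $(c^\lambda_{s,t})^*\equiv c^\lambda_{t,s}\bmod A^{>\lambda}$. The cell module $\Delta_\lambda$ is the free $R$-module on $\{c^\lambda_s:s\in\mathcal T(\lambda)\}$ with $a c^\lambda_s=\sum_v r^s_v(a)c^\lambda_v$. An order ideal $U\subseteq\Lambda$ is a subset with $\mu\in U,\ \gamma\ge\mu\Rightarrow\gamma\in U$; $A(U)$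 is the span of the $c^\lambda_{s,t}$ with $\lambda\in U$ (an ideal). An increasing sequence $(Q_i)$ of cellular algebras with the same identity is restriction coherent if for every cell module $\Delta$ of $Q_{i+1}$, the restriction of $\Delta$ to $Q_i$ has a filtration by $Q_i$-submodules whose subquotients are cell modules of $Q_i$. **Setting.** $\Gamma$ is an infinite multiplicity-free branching diagram, each $\Gamma_k$ carrying a partial order $\ge$. Order $\tilde\Gamma_n$ by: $(\gamma,n)\ge(\gamma',n)$ if $|\gamma|<|\gamma'|$, or if $|\gamma|=|\gamma'|=k$ and $\gamma\ge\gamma'$ in $\Gamma_k$. Let $\tilde\Gamma_n^0=\{(\gamma,n)\in\tilde\Gamma_n:|\gamma|<n\}$ (an order ideal). $(A_n)_{n\ge0}$, $(Q_n)_{n\ge0}$ are increasing sequences of unital algebras over an integral domain $R$ with field of fractions $F$. ''A field $K$ that is an $R$-module'' means a field with a ring homomorphism $R\to K$; superscripts denote specialization, $A_n^K=A_n\otimes_RK$, etc. **Axioms.** (1) $A_n$ and $Q_n$ have algebra involutions $*$; those on the $Q_n$ are consistent, i.e. there is an algebra involution on $\bigcup_nQ_n$ with $(Q_n)^*=Q_n$. (2) $A_0=Q_0=R$ and $A_1=Q_1$. (3) $(Q_n)$ is a restriction-coherent tower of cellular algebras, and the partially ordered set in the cell datum of $Q_n$ is $(\Gamma_n,\ge)$. (4) $R$ has characteristic zero. The algebras $Q_n^F$ are split semisimple and the branching diagram of $(Q_n^F)_{n\ge0}$ is $\Gamma$. For any field $K$ that is an $R$-module, either $Q_n^K$ is split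 semisimple for all $n$, or there is $n_1\ge0$ such that $Q_n^K$ is split semisimple for $n\le n_1$ and non-semisimple for $n>n_1$. (5) $A_n$ is cellular with partially ordered set $(\tilde\Gamma_n,\ge)$. (6) For $n\ge1$, $A_{n+1}$ contains an element $e_n$ with $e_n^2=\boldsymbol\delta e_n$, where $\boldsymbol\delta$ is invertible in $R$. The ideal $A_{n+1}e_nA_{n+1}$ coincides with $A_{n+1}(\tilde\Gamma^0_{n+1})$, and $A_{n+1}/(A_{n+1}e_nA_{n+1})\cong Q_{n+1}$. (7) $e_ne_{n\pm1}e_n=e_n$, and $e_ne_m=e_me_n$ if $|n-m|\ge2$. (8) For $n\ge1$, $e_n$ commutes with $A_{n-1}$ and $e_nA_ne_n\subseteq A_{n-1}e_n$. (9) For $n\ge1$, $A_{n+1}e_n=A_ne_n$, and $x\mapsto xe_n$ is injective from $A_n$ to $A_ne_n$. Put $\bar e_n=\boldsymbol\delta^{-1}e_n$. By (8),(9) there is a unique map $E^n_{n-1}:A_n\to A_{n-1}$ with $\bar e_nx\bar e_n=\bar e_nE^n_{n-1}(x)$; it is a unital $A_{n-1}$-$A_{n-1}$-bimodule map (conditional expectation). Define $\mathrm{tr}:\bigcup_nA_n\to R$ by $\mathrm{tr}(1)=1$ and $\mathrm{tr}(x)=\mathrm{tr}(E^n_{n-1}(x))$ for $x\in A_n$. The same definitions apply to, and are compatible with, specializations $A_n^S=A_n\otimes_RS$. (10) $\mathrm{tr}$ is a trace: $\mathrm{tr}(xy)=\mathrm{tr}(yx)$ for $x,y\in A_n$. (11)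 $\mathrm{tr}$ on $A_n^F$ is non-degenerate for all $n$. (12) Suppose $k<n$ with $n-k$ even, $s=(n-k)/2$, and $(\gamma,k)\in\tilde\Gamma_k$. If $x\in A_k^{\ge(\gamma,k)}\setminus A_k^{>(\gamma,k)}$, then $x\,e_{k+1}e_{k+3}\cdots e_{n-1}\in A_n^{\ge(\gamma,n)}\setminus A_n^{>(\gamma,n)}$. A trace $\tau$ on an algebra $A$ is degenerate if there is $0\ne x\in A$ with $\tau(xy)=0$ for all $y\in A$, and non-degenerate (faithful) otherwise.
   Formalization: The isomorphisms A_1 = Q_1 and A_{n+1}/(A_{n+1}e_nA_{n+1}) ≅ Q_{n+1} are assumed compatible with the inclusions A_n ⊂ A_{n+1} and Q_n ⊂ Q_{n+1}; with bare isomorphisms the branching diagram of (A_n) need not be the reflection of Γ. *)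

(* Defs.v *)
From HB Require Import structures.
From mathcomp Require Import all_boot all_order all_algebra.
From mathcomp Require Import finmap.

Set Implicit Arguments.
Unset Strict Implicit.
Unset Printing Implicit Defensive.

Import Order.TTheory GRing.Theory.

Local Open Scope ring_scope.

(* [bd_up v w] is the relation v \nearrow w; being a relation, it makes the diagram
   multiplicity-free.  The partial orders of the levels are unrelated to the
   edges. *)
Record branching_diagram (d : Order.disp_t) := BranchingDiagram {
  bd_level :> nat -> finPOrderType d;
  bd_up : rel {k : nat & bd_level k};
  bd_root : #|bd_level 0| = 1%N;
  bd_up_level : forall v w, bd_up v w -> tag w = (tag v).+1;
  bd_down : forall w : {k : nat & bd_level k},
    (0 < tag w)%N -> exists v, bd_up v w
}.

Arguments bd_up {d} _ _ _.

Definition vertex (d : Order.disp_t) (G : branching_diagram d) : Type :=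
  {k : nat & G k}.

Definition vertex_at (d : Order.disp_t) (G : branching_diagram d)
  (k : nat) (v : G k) : vertex G := existT _ k v.

Definition bd_infinite (d : Order.disp_t) (G : branching_diagram d) : Prop :=
  forall s : seq {k : nat & G k}, exists v, v \notin s.

Section Reflection.
Variables (d : Order.disp_t) (G : branching_diagram d).

(* An element of [reflected n] is the vertex (v, n) of the reflected diagram,
   given by v. *)
Definition reflected (n : nat) : Type :=
  {v : {k : 'I_n.+1 & G k} | ~~ odd (n - tag v)}.

HB.instance Definition _ n := Finite.on (reflected n).

Definition under n (v : reflected n) : vertex G := vertex_at (tagged (val v)).

Definition reflected_up n (v : reflected n) (w : reflected n.+1) : bool :=
  bd_up G (under v) (under w) || bd_up G (under w) (under v).

(* Vertices of smaller level in G are larger; tagged_as is a cast between equal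
   levels. *)
Definition reflected_le n (v w : reflected n) : bool :=
  (tag (under w) < tag (under v))%N ||
  ((tag (under v) == tag (under w)) &&
   (tagged (under v) <= tagged_as (under v) (under w))%O).

Lemma under_inj n : injective (@under n).
Proof.
move=> [[k v] kP] [[l w] lP]; rewrite /under /= => E.
apply: val_inj => /=.
have Ekl : k = l by apply: val_inj; apply: (congr1 (@tag _ _) E).
case: l / Ekl w lP E => w lP E.
by congr existT; exact: (eq_from_Tagged E).
Qed.

Lemma reflected_le_refl n : reflexive (@reflected_le n).
Proof. by move=> v; rewrite /reflected_le eqxx tagged_asE lexx orbT. Qed.

Lemma reflected_le_anti n : antisymmetric (@reflected_le n).
Proof.
move=> v w H; apply: under_inj; move: H.
rewrite /reflected_le; case: (under v) (under w) => [k a] [l b] /=.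
case: (ltngtP k l) => //= Ekl; case: l / Ekl b => b.
by rewrite !tagged_asE => /le_anti ->.
Qed.

Lemma reflected_le_trans n : transitive (@reflected_le n).
Proof.
move=> w v u; rewrite /reflected_le.
case: (under v) (under w) (under u) => [k a] [l b] [m c] /=.
move=> /orP[lk|/andP[/eqP Ekl]].
  move=> /orP[ml|/andP[/eqP Elm _]]; first by rewrite (ltn_trans ml lk).
  by case: m / Elm c => c; rewrite lk.
case: l / Ekl b => b; rewrite tagged_asE => ab.
move=> /orP[->//|/andP[/eqP Ekm]]; case: m / Ekm c => c.
by rewrite eqxx !tagged_asE ltnn; apply: le_trans.
Qed.

Fact reflected_display : Order.disp_t. Proof. exact: Order.Disp tt tt. Qed.

HB.instance Definition _ n :=
  Order.Le_isPOrder.Build reflected_display (reflected n)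
    (@reflected_le_refl n) (@reflected_le_anti n) (@reflected_le_trans n).

End Reflection.

Section Restriction.
Variables (B C : nzRingType) (f : {rmorphism B -> C}) (M : lmodType C).

(* M as a B-module, b acting as f b. *)
Definition res of {rmorphism B -> C} : Type := M.
Local Notation resM := (res f).

HB.instance Definition _ := GRing.Zmodule.on resM.

Let scale (b : B) (x : resM) : resM := (f b *: (x : M)).

Fact res_scaleA a b x : scale a (scale b x) = scale (a * b) x.
Proof. by rewrite /scale scalerA rmorphM. Qed.
Fact res_scale1 : left_id 1 scale.
Proof. by move=> x; rewrite /scale rmorph1 scale1r. Qed.
Fact res_scaleDr : right_distributive scale +%R.
Proof. by move=> a x y; apply: scalerDr. Qed.
Fact res_scaleDl x : {morph scale^~ x : a b / a + b}.
Proof. by move=> a b; rewrite /scale rmorphD scalerDl. Qed.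

HB.instance Definition _ := GRing.Zmodule_isLmodule.Build B resM
  res_scaleA res_scale1 res_scaleDr res_scaleDl.
End Restriction.

Section Modules.
Variable B : nzRingType.

Definition submodule (M : lmodType B) (F : M -> Prop) : Prop :=
  F 0 /\ forall a x y, F x -> F y -> F (a *: x + y).

Definition isomorphic (M N : lmodType B) : Prop :=
  exists g : {linear M -> N}, bijective g.

Definition simple_module (M : lmodType B) : Prop :=
  (exists x : M, x != 0) /\
  forall F : M -> Prop, submodule F ->
    (forall x, F x -> x = 0) \/ (forall x, F x).

(* F / F' is isomorphic to N, for submodules F' of F of M. *)
Definition subquotient (M : lmodType B) (F F' : M -> Prop) (N : lmodType B) :=
  exists g : M -> N,
    [/\ forall a x y, F x -> F y -> g (a *: x + y) = a *: g x + g y,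
        forall z, exists2 x, F x & g x = z
      & forall x, F x -> (g x = 0 <-> F' x)].

(* F has a chain of submodules F > F_1 > ... > F_m = 0, the successive
   quotients of which are modules in the classes S l, for l in ls. *)
Fixpoint filtered (M : lmodType B) (I : Type) (S : I -> lmodType B -> Prop)
    (F : M -> Prop) (ls : seq I) : Prop :=
  if ls is l :: ls' then
    exists F' : M -> Prop,
      [/\ submodule F', forall x, F' x -> F x,
          exists2 N, S l N & subquotient F F' N
        & filtered S F' ls']
  else forall x, F x -> x = 0.

Definition has_filtration (M : lmodType B) (I : Type)
    (S : I -> lmodType B -> Prop) (ls : seq I) : Prop :=
  filtered S (fun _ : M => True) ls.

(* Every left ideal has a complement. *)
Definition semisimple : Prop :=
  forall F : B^o -> Prop, submodule F ->
  exists F' : B^o -> Prop,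
    [/\ submodule F', forall x, F x -> F' x -> x = 0
      & forall x, exists y z, [/\ F y, F' z & x = y + z]].

End Modules.

Arguments semisimple B : clear implicits.

(* B is isomorphic, via x |-> (g i x)_i, to a finite product of full matrix
   algebras over K. *)
Definition split_semisimple (K : fieldType) (B : algType K) : Prop :=
  exists (I : finType) (n : I -> nat)
         (g : forall i, {lrmorphism B -> 'M[K]_((n i).+1)}),
    forall y : (forall i, 'M[K]_((n i).+1)), exists! x, forall i, g i x = y i.

(* The branching diagram of the maps f n : B n -> B n.+1, for the levels n
   such that P n, has L n as set of vertices of level n and [E n v w] edges
   between v and w.  The multiplicity of a simple module is its number of
   occurrences in a composition series. *)
Definition has_branching_diagram (K : fieldType) (B : nat -> algType K)
    (f : forall n, {lrmorphism B n -> B n.+1}) (P : pred nat)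
    (L : nat -> finType) (E : forall n, L n -> L n.+1 -> nat) : Prop :=
  exists S : forall n, L n -> lmodType (B n),
    (forall n, P n ->
       [/\ forall v, simple_module (S n v),
           forall v v', isomorphic (S n v) (S n v') -> v = v'
         & forall M : lmodType (B n), simple_module M ->
             exists v, isomorphic M (S n v)]) /\
    (forall n, P n -> P n.+1 -> forall w : L n.+1,
       exists2 vs : seq (L n),
         has_filtration (res (S n.+1 w) (f n))
           (fun v N => isomorphic N (S n v)) vs
         & forall v, count_mem v vs = E n v w).

Arguments has_branching_diagram {K B} f P L E.

Section Span.
Variables (R : nzRingType) (M : lmodType R) (I : choiceType) (b : I -> M).

Definition lincomb (u : {fsfun I -> R with 0}) : M :=
  \sum_(i <- finsupp u) u i *: b i.

Definition is_basis : Prop := forall x, exists! u, lincomb u = x.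

Definition in_span (P : I -> Prop) (x : M) : Prop :=
  exists2 u, (forall i, i \in finsupp u -> P i) & lincomb u = x.

End Span.

Definition algebra_involution (R : idomainType) (A : algType R)
    (inv : A -> A) : Prop :=
  [/\ forall r x y, inv (r *: x + y) = r *: inv x + inv y,
      forall x y, inv (x * y) = inv y * inv x
    & involutive inv].

Definition cell_elt (R : idomainType) (A : algType R) (L : Type)
    (T : L -> choiceType) (c : forall l, T l -> T l -> A)
    (i : {l : L & (T l * T l)%type}) : A :=
  c (tag i) (tagged i).1 (tagged i).2.

Record cell_datum (R : idomainType) (A : algType R) (inv : A -> A)
    (d : Order.disp_t) (L : porderType d) := CellDatum {
  cell_T : L -> choiceType;
  cell_c : forall l, cell_T l -> cell_T l -> A;
  cell_r : forall l, A -> cell_T l -> {fsfun cell_T l -> R with 0};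
  cell_basis : is_basis (cell_elt cell_c);
  cell_mul : forall l a (s t : cell_T l),
    in_span (cell_elt cell_c) (fun i => (l < tag i)%O)
      (a * cell_c s t - lincomb (fun v => cell_c v t) (cell_r a s));
  cell_inv : forall l (s t : cell_T l),
    in_span (cell_elt cell_c) (fun i => (l < tag i)%O)
      (inv (cell_c s t) - cell_c t s)
}.

Section Cellular.
Variables (R : idomainType) (A : algType R) (inv : A -> A).
Variables (d : Order.disp_t) (L : porderType d) (D : cell_datum inv L).

(* The span of the c^l_{s,t} with U l. *)
Definition cell_span (U : L -> Prop) : A -> Prop :=
  in_span (cell_elt (@cell_c _ _ _ _ _ D)) (fun i => U (tag i)).

(* M is (isomorphic to) the cell module of l: it has an R-basis b indexed by
   T(l) on which A acts through the coefficients r.  Here R acts on M through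
   R -> A. *)
Definition is_cell_module (l : L) (M : lmodType A) : Prop :=
  exists b : cell_T D l -> res M (in_alg A),
    is_basis b /\
    forall a s, (a *: (b s : M)) = lincomb b (cell_r a s).

End Cellular.

(* An increasing sequence of algebras, with union [tw_union]; the algebras
   are identified with subalgebras of the union through [tw_emb]. *)
Record tower (R : idomainType) := Tower {
  tw_alg :> nat -> algType R;
  tw_union : algType R;
  tw_incl : forall n, {lrmorphism tw_alg n -> tw_alg n.+1};
  tw_emb : forall n, {lrmorphism tw_alg n -> tw_union};
  tw_emb_inj : forall n, injective (tw_emb n);
  tw_emb_incl : forall n x, tw_emb n.+1 (tw_incl n x) = tw_emb n x;
  tw_exhaust : forall z, exists n x, tw_emb n x = z
}.

Arguments tw_incl {R} _ _.
Arguments tw_emb {R} _ _.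

(* B, with phi : A -> B, is the K-algebra A \otimes_R K, with x |-> x \otimes 1:
   phi is universal among the R-linear maps from A to K-vector spaces. *)
Definition is_base_change (R : idomainType) (K : fieldType)
    (rho : {rmorphism R -> K}) (A : algType R) (B : algType K)
    (phi : {rmorphism A -> B}) : Prop :=
  (forall r x, phi (r *: x) = rho r *: phi x) /\
  forall (V : lmodType K) (f : {additive A -> V}),
    (forall r x, f (r *: x) = rho r *: f x) ->
    exists g : {linear B -> V},
      (forall x, g (phi x) = f x) /\
      forall g' : {linear B -> V}, (forall x, g' (phi x) = f x) -> g' =1 g.

(* The sequence of the specializations of the algebras of T, with the maps
   induced by the inclusions. *)
Record specialization (R : idomainType) (K : fieldType)
    (rho : {rmorphism R -> K}) (T : tower R) := Specialization {
  sp_alg :> nat -> algType K;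
  sp_map : forall n, {rmorphism T n -> sp_alg n};
  sp_base_change : forall n, is_base_change rho (sp_map n);
  sp_incl : forall n, {lrmorphism sp_alg n -> sp_alg n.+1};
  sp_incl_map : forall n x,
    sp_incl n (sp_map n x) = sp_map n.+1 (tw_incl T n x)
}.

Arguments sp_map {R K rho T} _ _.
Arguments sp_incl {R K rho T} _ _.

Definition degenerate (K : fieldType) (B : algType K) (tau : B -> K) : Prop :=
  exists x, x != 0 /\ forall y, tau (x * y) = 0.

(* The functionals trK are the K-linear extensions of tr. *)
Definition specialized_trace (R : idomainType) (K : fieldType)
    (rho : {rmorphism R -> K}) (T : tower R) (TK : specialization rho T)
    (tr : tw_union T -> R) (trK : forall n, {scalar TK n}) : Prop :=
  forall n x, trK n (sp_map TK n x) = rho (tr (tw_emb T n x)).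

Section Framework.
Variables (R : idomainType) (d : Order.disp_t) (G : branching_diagram d).
Variables (A Q : tower R).

Local Notation F := {fraction R}.
Local Notation toF := (@FracField.tofrac R).
Local Notation j := (tw_emb A).
Local Notation AU := (tw_union A).

Definition reflected_ge n (v : reflected G n) : reflected G n -> Prop :=
  fun w => (v <= w)%O.
Definition reflected_gt n (v : reflected G n) : reflected G n -> Prop :=
  fun w => (v < w)%O.
Definition reflected_low n : reflected G n -> Prop :=
  fun v => (tag (under v) < n)%N.

(* The ideal B e B. *)
Definition two_sided_ideal (B : nzRingType) (e x : B) : Prop :=
  exists s : seq (B * B), x = \sum_(p <- s) p.1 * e * p.2.

Record framework := Framework {
  fw_invA : forall n, A n -> A n;
  fw_invQ : forall n, Q n -> Q n;
  fw_invAP : forall n, algebra_involution (@fw_invA n);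
  fw_invQP : forall n, algebra_involution (@fw_invQ n);
  fw_invQ_consistent : exists inv : tw_union Q -> tw_union Q,
    algebra_involution inv /\
    forall n x, inv (tw_emb Q n x) = tw_emb Q n (fw_invQ x);

  (* The projections A_n -> Q_n, with kernel A_n e_{n-1} A_n for n >= 2 and
     bijective for n <= 1.  The compatibility fw_pi_incl of the isomorphisms
     A_n / A_n e_{n-1} A_n ~ Q_n with the inclusions is needed for the diagram
     of (Q_n) to determine that of (A_n). *)
  fw_pi : forall n, {lrmorphism A n -> Q n};
  fw_pi_surj : forall n y, exists x, fw_pi n x = y;
  fw_pi_incl : forall n x,
    fw_pi n.+1 (tw_incl A n x) = tw_incl Q n (fw_pi n x);

  fw_A0 : bijective (in_alg (A 0));
  fw_Q0 : bijective (in_alg (Q 0));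
  fw_A1 : bijective (fw_pi 1);

  fw_cellQ : forall n, cell_datum (@fw_invQ n) (G n);
  fw_coherent : forall n (l : G n.+1) (M : lmodType (Q n.+1)),
    is_cell_module (fw_cellQ n.+1) l M ->
    exists ls : seq (G n),
      has_filtration (res M (tw_incl Q n)) (is_cell_module (fw_cellQ n)) ls;

  fw_char : [pchar R] =i pred0;
  fw_QF : specialization toF Q;
  fw_QF_split : forall n, split_semisimple (fw_QF n);
  fw_QF_branching : has_branching_diagram (sp_incl fw_QF) predT (fun n => G n)
    (fun n v w => bd_up G (vertex_at v) (vertex_at w));
  fw_QK : forall (K : fieldType) (rho : {rmorphism R -> K})
      (QK : specialization rho Q),
    (forall n, split_semisimple (QK n)) \/
    exists n1 : nat,
      (forall n, (n <= n1)%N -> split_semisimple (QK n)) /\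
      (forall n, (n1 < n)%N -> ~ semisimple (QK n));

  fw_cellA : forall n, cell_datum (@fw_invA n) (reflected G n);

  (* fw_e n is the element e_n of A_{n+1}, for n >= 1; fw_e 0 is irrelevant. *)
  fw_e : forall n, A n.+1;
  fw_delta : R;
  fw_delta_unit : fw_delta \is a GRing.unit;
  fw_e_sqr : forall n, (0 < n)%N -> fw_e n * fw_e n = fw_delta *: fw_e n;
  fw_ideal : forall n, (0 < n)%N -> forall x,
    two_sided_ideal (fw_e n) x <->
    cell_span (fw_cellA n.+1) (@reflected_low n.+1) x;
  fw_pi_ker : forall n, (0 < n)%N -> forall x,
    fw_pi n.+1 x = 0 <-> two_sided_ideal (fw_e n) x;

  fw_ee := fun n => j n.+1 (fw_e n) : AU;
  fw_e_up : forall n, (0 < n)%N -> fw_ee n * fw_ee n.+1 * fw_ee n = fw_ee n;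
  fw_e_down : forall n, (0 < n)%N ->
    fw_ee n.+1 * fw_ee n * fw_ee n.+1 = fw_ee n.+1;
  fw_e_comm : forall n m, (0 < n)%N -> (n + 2 <= m)%N ->
    fw_ee n * fw_ee m = fw_ee m * fw_ee n;

  fw_e_comm_A : forall n, (0 < n)%N -> forall x : A n.-1,
    fw_ee n * j n.-1 x = j n.-1 x * fw_ee n;
  fw_eAe : forall n, (0 < n)%N -> forall x : A n, exists y : A n.-1,
    fw_ee n * j n x * fw_ee n = j n.-1 y * fw_ee n;

  fw_Ae : forall n, (0 < n)%N -> forall x : A n.+1, exists y : A n,
    j n.+1 x * fw_ee n = j n y * fw_ee n;
  fw_Ae_inj : forall n, (0 < n)%N -> injective (fun x : A n => j n x * fw_ee n);

  (* The conditional expectations and tr; both exist and are unique by the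
     previous fields. *)
  fw_ebar := fun n => fw_delta^-1 *: fw_ee n;
  fw_E : forall n, A n.+1 -> A n;
  fw_EP : forall n x,
    fw_ebar n.+1 * j n.+1 x * fw_ebar n.+1 = fw_ebar n.+1 * j n (fw_E x);
  fw_tr : {scalar AU};
  fw_tr1 : fw_tr 1 = 1;
  fw_tr_E : forall n x, fw_tr (j n.+1 x) = fw_tr (j n (fw_E x));

  fw_trC : forall n (x y : A n), fw_tr (j n (x * y)) = fw_tr (j n (y * x));

  fw_AF : specialization toF A;
  fw_trF : forall n, {scalar fw_AF n};
  fw_trFP : specialized_trace fw_tr fw_trF;
  fw_trF_nondeg : forall n, ~ degenerate (fw_trF n);

  fw_shift : forall k s, (0 < s)%N ->
    forall (v : reflected G k) (v' : reflected G (k + s.*2)),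
    under v = under v' ->
    forall x : A k,
      cell_span (fw_cellA k) (reflected_ge v) x ->
      ~ cell_span (fw_cellA k) (reflected_gt v) x ->
    exists y : A (k + s.*2),
      [/\ j (k + s.*2) y = j k x * \prod_(i < s) fw_ee (k + i.*2.+1),
          cell_span (fw_cellA (k + s.*2)) (reflected_ge v') y
        & ~ cell_span (fw_cellA (k + s.*2)) (reflected_gt v') y]
}.

End Framework.

(* Indices in nat with infinity are elements of option nat, None standing for
   infinity. *)
Definition smallest (P : nat -> Prop) (o : option nat) : Prop :=
  match o with
  | Some n => P n /\ forall k, (k < n)%N -> ~ P k
  | None => forall k, ~ P k
  end.

Definition ole (k : nat) (o : option nat) : bool :=
  if o is Some n then (k <= n)%N else true.

Definition omin (o o' : option nat) : option nat :=
  match o, o' with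
  | Some n, Some n' => Some (minn n n')
  | Some n, None => Some n
  | None, _ => o'
  end.

(* Main.v *)
(* Call idempotents p_i of a K-algebra B a system if p_i B p_i = K p_i, p_i B p_j = 0 for i <> j,
   and 1 lies in the sum of the ideals B p_i B: then B is split semisimple with simple modules
   B p_i, and for B -> C the multiplicity of B p in the restriction of C q is dim (p C q).

   The systems of the A_n are built by induction on n.  Let ebar be the idempotent proportional to
   e_{n+1}, J the ideal that it generates in A_{n+2}, and p_g, p'_m the systems of A_n, A_{n+1}.
   Nondegeneracy of the trace on A_{n+1} turns a generator w of the line p'_m A_{n+1} p_g into a
   dual pair (w, w') with E(w' w) = p_g, and 1 = sum x p'_m y then gives the left unit
   sum (x w) ebar (w' y) of J.  The involution preserves J, so J has a two-sided unit z, which is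
   central in A_{n+2}, and A_{n+2} = J x Q_{n+2}.  The p_g ebar and the lifts to 1 - z of the system
   of Q_{n+2} form a system of A_{n+2}; the symmetry dim (p C q) = dim (q C p) (Frobenius
   reciprocity) is the reflection in the branching diagram.

   For Q_n^K, the common kernel of the cell representations is nilpotent, so these representations
   identify Q_n^K with a product of matrix algebras.  Restriction coherence puts the restriction of
   a cell representation in block triangular form over R, and its multiplicities can be read off
   over the fraction field from traces, since R has characteristic 0.  They are at most 1, so over
   K the rank of a diagonal idempotent is determined by an upper bound and a trace. *)

From HB Require Import structures.
Require Import Defs.
From mathcomp Require Import all_boot all_order all_algebra.
From mathcomp Require Import finmap boolp.

Set Implicit Arguments.
Unset Strict Implicit.
Unset Printing Implicit Defensive.

Import Order.TTheory GRing.Theory.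
Local Open Scope ring_scope.

(** * Systems of primitive idempotents *)

(** Finite dimension of [B] is not asked for: it is a consequence of the last clause together with
    the one-dimensional corners. *)
Definition idem_system (K : fieldType) (B : algType K) (I : finType)
    (p : I -> B) : Prop :=
  [/\ forall i, p i != 0,
      forall i, p i * p i = p i,
      forall i b, exists c, p i * b * p i = c *: p i,
      forall i j b, i != j -> p i * b * p j = 0
    & exists s : seq (I * (B * B)), 1 = \sum_(t <- s) t.2.1 * p t.1 * t.2.2].

(** States that [p B q] has dimension [e]. A boolean is enough because the diagrams are
    multiplicity-free; for images of idempotents of two systems it is the multiplicity in a
    restriction. *)
Definition line (K : fieldType) (B : algType K) (p q : B) (e : bool) : Prop :=
  if e then exists w, [/\ w != 0, p * w * q = w & forall b, exists c, p * b * q = c *: w]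
  else forall b, p * b * q = 0.

Section LeftIdeal.
Variables (B : nzRingType) (p : B).

(** For an idempotent [p] this is the left ideal [B p]. The equation [x p = x] makes membership
    boolean, as the subtype construction requires. *)
Definition left_ideal_pred : {pred B^o} := [pred x : B^o | (x : B) * p == x].

Fact left_ideal_submod : submod_closed left_ideal_pred.
Proof.
split=> [|a x y]; rewrite !inE ?mul0r // => /eqP xp /eqP yp.
by rewrite mulrDl -[a *: x]/((a : B) * (x : B)) -mulrA xp yp.
Qed.

HB.instance Definition _ :=
  GRing.isSubmodClosed.Build B B^o left_ideal_pred left_ideal_submod.

Record left_ideal : Type := LeftIdeal
  { left_ideal_val : B^o; _ : left_ideal_val \in left_ideal_pred }.

HB.instance Definition _ := [isSub for left_ideal_val].
HB.instance Definition _ := [Choice of left_ideal by <:].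
HB.instance Definition _ := [SubChoice_isSubLmodule of left_ideal by <:].

End LeftIdeal.

Section IdemSystem.
Variables (K : fieldType) (B : algType K) (I : finType) (p : I -> B).
Hypothesis sysp : idem_system p.

Local Notation lv x := (left_ideal_val x : B).

Lemma idem_neq0 i : p i != 0. Proof. by case: sysp. Qed.

Lemma idemM i : p i * p i = p i. Proof. by case: sysp. Qed.

Lemma idem_scalar i b : exists c, p i * b * p i = c *: p i.
Proof. by case: sysp. Qed.

Lemma idem_ortho i j b : i != j -> p i * b * p j = 0.
Proof. by case: sysp => _ _ _ + _; apply. Qed.

(** Expand [m = 1 m] along the decomposition of 1 into terms [a p_i b]: some [p_i b m] must
    survive. *)
Lemma idem_module_neq0 (M : lmodType B) (m : M) :
  m != 0 -> exists i y, (p i * y) *: m != 0.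
Proof.
case: sysp => _ _ _ _ [s s1] /eqP m0; apply: contrapT => h; apply: m0.
rewrite -[m]scale1r s1 scaler_suml big1 // => t _.
rewrite -mulrA -scalerA; have [->|/eqP nz] := EM ((p t.1 * t.2.2) *: m = 0).
  by rewrite scaler0.
by case: h; exists t.1, t.2.2.
Qed.

Lemma idem_left_idealP i b : (b * p i : B^o) \in left_ideal_pred (p i).
Proof. by rewrite inE -mulrA idemM. Qed.

Definition idem_left i b : left_ideal (p i) := LeftIdeal (idem_left_idealP i b).

Lemma left_idealM i (x : left_ideal (p i)) : (lv x) * p i = lv x.
Proof. by case: x => x /= /eqP. Qed.

(** A nonzero [x] in [B p_i] has some [p_i z x = c p_i] with [c] nonzero, so [x] generates [p_i] and
    with it all of [B p_i]. *)
Lemma left_ideal_simple i : simple_module (left_ideal (p i)).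
Proof.
split.
  exists (idem_left i 1); rewrite -val_eqE /= mul1r; exact: idem_neq0.
move=> F [F0 FD]; have FZ a x : F x -> F (a *: x).
  by move=> Fx; rewrite -[_ *: _]addr0; apply: FD.
have [h|/existsNP [x /not_implyP[Fx /eqP x0]]] := EM (forall x, F x -> x = 0).
  by left.
right=> y; have [j [z]] := idem_module_neq0 x0.
rewrite -val_eqE /= -[X in X != _]/(p j * z * (lv x)) -(left_idealM x) mulrA.
have [->|/idem_ortho] := eqVneq j i; last by rewrite -(mulrA _ z) => ->; rewrite eqxx.
rewrite -(mulrA _ z); have [c pc] := idem_scalar i (z * lv x).
rewrite pc scaler_eq0 negb_or => /andP[c0 _].
suff -> : y = ((lv y) * (c^-1 *: (p i * z))) *: x by apply: FZ.
apply: val_inj; rewrite /= -[RHS]/((lv y) * (c^-1 *: (p i * z)) * (lv x)).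
rewrite -(left_idealM x) -mulrA -scalerAl (mulrA (p i * z)) -(mulrA _ z) pc scalerA.
by rewrite mulVf // scale1r left_idealM.
Qed.

(** A module map is determined by the image of [p_i], which lies in [p_i B p_j]; this corner is 0
    for distinct indices. *)
Lemma left_ideal_inj i j : isomorphic (left_ideal (p i)) (left_ideal (p j)) -> i = j.
Proof.
move=> [g /bij_inj gi]; apply: contrapT => /eqP ij.
have e : idem_left i 1 = p i *: idem_left i 1.
  by apply: val_inj; rewrite /= mul1r -[RHS]/(p i * p i) idemM.
have : g (idem_left i 1) = 0.
  rewrite e linearZ /=; set z := g _; apply: val_inj.
  by rewrite /= -[LHS]/(p i * (lv z)) -(left_idealM z) mulrA idem_ortho.
rewrite -(linear0 g) => /gi /(congr1 val); rewrite /= mul1r.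
by apply/eqP/idem_neq0.
Qed.

(** Schur's argument: some vector [m] of [M] has [p_i m] nonzero, and [z |-> z m] is then a nonzero
    map between the simple modules [B p_i] and [M]. *)
Lemma simple_left_ideal (M : lmodType B) :
  simple_module M -> exists i, isomorphic M (left_ideal (p i)).
Proof.
case=> [[x x0] Ms]; have [i [y]] := idem_module_neq0 x0.
rewrite -scalerA; set m := y *: x => m0; exists i.
pose h (z : left_ideal (p i)) : M := (lv z) *: m.
have hD a u v : h (a *: u + v) = a *: h u + h v.
  by rewrite /h [X in _ = X + _]scalerA; exact: (scalerDl m (a * lv u) (lv v)).
have h0 : h 0 = 0 by rewrite /h scale0r.
have hi : injective h.
  move=> u v uv; apply/eqP; rewrite -subr_eq0; apply/eqP.
  have [_ /(_ (fun u => h u = 0)) hker] := left_ideal_simple i.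
  have [||h1] := hker; first by split=> // a u' v' hu hv; rewrite hD hu hv scaler0 addr0.
    by apply; rewrite addrC -scaleN1r hD uv scaleN1r addNr.
  by move: (h1 (idem_left i 1)); rewrite /h /= mul1r => e; rewrite e eqxx in m0.
have hs v : exists u, h u == v.
  have [||//] := Ms (fun v => exists u, h u == v).
    split; first by exists 0; rewrite h0.
    by move=> a _ _ [u1 /eqP <-] [u2 /eqP <-]; exists (a *: u1 + u2); rewrite hD.
  move=> h1; case/eqP: m0; apply: h1.
  by exists (idem_left i 1); rewrite /h /= mul1r.
pose g v := xchoose (hs v).
have gK : cancel g h by move=> v; apply/eqP/(xchooseP (hs v)).
have hK : cancel h g by move=> u; apply: hi; rewrite gK.
have gD : linear g.
  by move=> a u v; apply: hi; rewrite hD !gK.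
pose gl := GRing.isLinear.Build _ _ _ _ g gD.
pose G : {linear M -> left_ideal (p i)} := HB.pack g gl.
by exists G; exists h.
Qed.

Lemma isomorphic_refl (M : lmodType B) : isomorphic M M.
Proof. by exists idfun; exists idfun. Qed.

End IdemSystem.

Lemma scaler_injr (K : fieldType) (V : lmodType K) (v : V) :
  v != 0 -> injective (fun a : K => a *: v).
Proof.
move=> v0 a b /eqP; rewrite -subr_eq0 -scalerBl scaler_eq0 (negPf v0) orbF subr_eq0.
by move/eqP.
Qed.

(** With [C = V U] of full rank, [V (U V) U = V U]; cancelling [V] on the left and [U] on the right
    leaves [U V = 1]. *)
Lemma idempotent_base (K : fieldType) N (C : 'M[K]_N) :
  C *m C = C -> row_base C *m col_base C = 1%:M.
Proof.
move=> CC; have /mulVpmx VL := col_base_full C; have /mulmxVp UR := row_base_free C.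
have := mulmx_base C; move: (col_base C) (row_base C) VL UR => V U VL UR VU.
have: V *m (U *m V) *m U = V *m U by rewrite mulmxA VU -mulmxA VU CC.
move: (pinvmx V) (pinvmx U) VL UR => V' U' VL UR.
move=> /(congr1 (fun M => V' *m M *m U')).
by rewrite !mulmxA VL !mul1mx -!mulmxA UR !mulmx1.
Qed.

(** * Matrix units obtained from a system of idempotents *)

Section SplitSemisimple.
Variables (K : fieldType) (B : algType K).

(* The Gram matrix C of a spanning family of B q is idempotent; a full rank factorization C = V U
   cuts the family down to a basis with its dual basis. *)
Lemma dual_bases (q : B) (N : nat) (x y : 'I_N -> B) :
    (forall b, exists c, q * b * q = c *: q) ->
    (forall k, x k * q = x k) -> (forall k, q * y k = y k) ->
    (forall l, (\sum_k x k * y k) * x l = x l) ->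
  exists r (x' y' : 'I_r -> B),
    [/\ forall k, x' k * q = x' k, forall k, q * y' k = y' k,
        forall k l, y' k * x' l = (k == l)%:R *: q
      & \sum_k x' k * y' k = \sum_k x k * y k].
Proof.
move=> qs xq qy xyx.
have [C0 C0P] := choice (fun kl : 'I_N * 'I_N => qs (y kl.1 * x kl.2)).
pose C : 'M[K]_N := \matrix_(k, l) C0 (k, l).
have CP k l : y k * x l = C k l *: q.
  by rewrite mxE -C0P /= mulrA qy -mulrA xq.
have Cx l : \sum_k C k l *: x k = x l.
  rewrite -[RHS]xyx mulr_suml; apply: eq_bigr => k _.
  by rewrite -mulrA CP -scalerAr xq.
have [q0|q0] := eqVneq q 0.
  exists 0, (fun _ => 0), (fun _ => 0); split; try by case.
  rewrite big_ord0 big1 // => k _.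
  by rewrite -xq q0 mulr0 mul0r.
have CC : C *m C = C.
  apply/matrixP=> k l; rewrite mxE.
  apply: (scaler_injr q0) => /=.
  rewrite -CP -[in RHS](Cx l) mulr_sumr scaler_suml; apply: eq_bigr => m _.
  by rewrite -scalerAr CP scalerA mulrC.
have := idempotent_base CC; have := mulmx_base C.
move: (\rank C) (col_base C) (row_base C) => r V U VU UV.
exists r, (fun j => \sum_k V k j *: x k), (fun i => \sum_l U i l *: y l).
split.
- by move=> k; rewrite mulr_suml; apply: eq_bigr => l _; rewrite -scalerAl xq.
- by move=> k; rewrite mulr_sumr; apply: eq_bigr => l _; rewrite -scalerAr qy.
- move=> i j; have <- : (U *m C *m V) i j = (i == j)%:R.
    by rewrite -VU -!mulmxA UV mulmx1 UV mxE.
  rewrite mulr_sumr mxE scaler_suml; apply: eq_bigr => k _.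
  rewrite mulr_suml mxE mulr_suml scaler_suml; apply: eq_bigr => l _.
  by rewrite -scalerAl -scalerAr CP !scalerA mulrAC.
- under eq_bigr do rewrite mulr_suml.
  rewrite exchange_big /=.
  under eq_bigr => k _ do under eq_bigr => j _ do rewrite mulr_sumr.
  under eq_bigr => k _ do rewrite exchange_big /=.
  rewrite exchange_big /=; apply: eq_bigr => l _.
  rewrite -[in RHS](Cx l) mulr_suml; apply: eq_bigr => k _.
  rewrite -VU mxE scaler_suml mulr_suml; apply: eq_bigr => j _.
  by rewrite -!scalerAl -scalerAr scalerA.
Qed.

Variables (I : finType) (p : I -> B).
Hypothesis sysp : idem_system p.

(** Grouping the terms [a p_i b] of the decomposition of 1 by their index [i] yields the units of
    the blocks [B p_i B]. *)
Lemma idem_central_units : exists e : I -> B,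
  [/\ 1 = \sum_i e i, forall i b j, i != j -> e i * (b * p j) = 0
    & forall i, exists N (x y : 'I_N -> B),
      [/\ forall k, x k * p i = x k, forall k, p i * y k = y k
        & \sum_k x k * y k = e i]].
Proof.
have [s s1] : exists s : seq (I * (B * B)), 1 = \sum_(t <- s) t.2.1 * p t.1 * t.2.2.
  by case: sysp.
exists (fun i => \sum_(t <- s | t.1 == i) t.2.1 * p t.1 * t.2.2); split.
- rewrite s1 [RHS](exchange_big_dep predT) //=; apply: eq_bigr => t _.
  by rewrite (big_pred1 t.1) // => i; apply: eq_sym.
- move=> i b j ij; rewrite mulr_suml big1 // => t /eqP ti.
  by rewrite !mulrA -!(mulrA t.2.1) -(mulrA (p t.1) _ b) idem_ortho ?mulr0 // ti.
move=> i; pose s' := [seq t <- s | t.1 == i].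
exists (size s'), (fun k => (tnth (in_tuple s') k).2.1 * p i),
  (fun k => p i * (tnth (in_tuple s') k).2.2); split=> [k|k|].
- by rewrite -mulrA idemM.
- by rewrite mulrA idemM.
rewrite -[RHS]big_filter -/s' (big_tnth _ _ s'); apply: eq_bigr => k _.
have /eqP -> : (tnth (in_tuple s') k).1 == i.
  by move: (mem_tnth k (in_tuple s')); rewrite mem_filter => /andP[].
by rewrite -mulrA (mulrA (p i)) idemM // !mulrA.
Qed.

(** Each block unit is rewritten by [dual_bases]; the products [x i k * y i l] are then matrix units
    of the block. *)
Lemma idem_matrix_units : exists (r : I -> nat) (x y : forall i, 'I_(r i).+1 -> B),
  [/\ forall i k, x i k * p i = x i k, forall i k, p i * y i k = y i k,
      forall i j b k l, i != j -> y i k * b * x j l = 0,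
      forall i k l, y i k * x i l = (k == l)%:R *: p i
    & 1 = \sum_i \sum_k x i k * y i k].
Proof.
have [e [e1 ep eP]] := idem_central_units.
have e_idem i : e i * p i = p i.
  rewrite -[RHS]mul1r e1 mulr_suml (bigD1 i) //= big1 ?addr0 // => j ji.
  by rewrite -[p i]mul1r ep.
have ex i : exists ryx : {r : nat & (('I_r.+1 -> B) * ('I_r.+1 -> B))%type},
    [/\ forall k, (tagged ryx).1 k * p i = (tagged ryx).1 k,
        forall k, p i * (tagged ryx).2 k = (tagged ryx).2 k,
        forall k l, (tagged ryx).2 k * (tagged ryx).1 l = (k == l)%:R *: p i
      & \sum_k (tagged ryx).1 k * (tagged ryx).2 k = e i].
  have [N [x [y [xp py xy]]]] := eP i.
  have [||//|l|[|r] [x' [y' [xp' py' yx' xy']]]] := @dual_bases (p i) N x y.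
  - exact: idem_scalar.
  - exact: xp.
  - rewrite xy -[RHS]mul1r e1 mulr_suml (bigD1 i) //= big1 ?addr0 // => j ji.
    by rewrite -xp ep.
  (* A block of size 0 would have block unit 0, against [e i * p i = p i]; hence the sizes of the
     form [(r i).+1]. *)
  - move: (e_idem i); rewrite -xy -xy' big_ord0 mul0r => /esym/eqP.
    by rewrite (negPf (idem_neq0 sysp i)).
  - exists (existT _ r (x', y')); split=> //=.
    by rewrite -xy -xy'.
have [f fP] := choice ex.
exists (fun i => tag (f i)), (fun i => (tagged (f i)).1), (fun i => (tagged (f i)).2).
split=> [i k|i k|i j b k l ij|i k l|]; try by case: (fP i).
  case: (fP i) (fP j) => _ + _ _ [+ _ _ _] => py xp; rewrite -py -xp.
  by rewrite !mulrA -(mulrA _ _ b) -(mulrA (p i)) idem_ortho ?mul0r // .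
by rewrite e1; apply: eq_bigr => i _; case: (fP i).
Qed.

(** [g i b] is the matrix of left multiplication by [b] on [B p_i] in the basis [x i], its entries
    being read off with the dual basis [y i]. *)
Lemma idem_system_split : split_semisimple B.
Proof.
have [r [x [y [xp py yx0 yx xy1]]]] := idem_matrix_units.
have [c cP] := choice (fun ib : I * B => idem_scalar sysp ib.1 ib.2).
have p_inj i : injective (fun a : K => a *: p i) by apply/scaler_injr/(idem_neq0 sysp).
pose g i b : 'M[K]_((r i).+1) := \matrix_(k, l) c (i, y i k * b * x i l).
have gE i b k l : y i k * b * x i l = g i b k l *: p i.
  by rewrite mxE -cP /= -{1}py -{1}xp !mulrA.
have gP i b (M : 'M[K]_((r i).+1)) :
    (forall k l, y i k * b * x i l = M k l *: p i) -> g i b = M.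
  by move=> h; apply/matrixP=> k l; apply: (p_inj i); rewrite -gE h.
have gl i : linear (g i).
  move=> a u v; apply: gP => k l.
  by rewrite mulrDr mulrDl -scalerAr -scalerAl !gE !mxE scalerDl scalerA.
have gm i : monoid_morphism (g i).
  split.
    by apply: gP => k l; rewrite mulr1 yx mxE.
  move=> u v; apply: gP => k l.
  have -> : y i k * (u * v) * x i l = \sum_m (y i k * u * x i m) * (y i m * v * x i l).
    rewrite -[u]mulr1 {1}xy1 mulr_sumr mulr_suml mulr_sumr mulr_suml.
    rewrite (bigD1 i) //= [X in _ + X]big1 ?addr0 => [|j ji].
      rewrite mulr_sumr mulr_suml mulr_sumr mulr_suml; apply: eq_bigr => m _.
      by rewrite mulr1 !mulrA.
    rewrite mulr_sumr mulr_suml mulr_sumr mulr_suml big1 // => m _.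
    by rewrite -!mulrA (mulrA (y j m)) [y j m * v * x i l]yx0 // !mulr0.
  rewrite mxE scaler_suml; apply: eq_bigr => m _.
  by rewrite !gE -scalerAl -scalerAr idemM // scalerA.
pose G i : {lrmorphism B -> 'M[K]_((r i).+1)} :=
  HB.pack (g i) (GRing.isLinear.Build _ _ _ _ (g i) (gl i))
    (GRing.isMonoidMorphism.Build _ _ (g i) (gm i)).
(* The preimage of a family of matrices is the corresponding combination of the matrix units. *)
exists I, r, G => M; exists (\sum_i \sum_k \sum_l M i k l *: (x i k * y i l)); split.
  move=> i; apply: gP => k l.
  rewrite mulr_sumr mulr_suml (bigD1 i) //= [X in _ + X]big1 ?addr0 => [|j ji].
    rewrite mulr_sumr mulr_suml (bigD1 k) //= [X in _ + X]big1 ?addr0 => [|k' kk].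
      rewrite mulr_sumr mulr_suml (bigD1 l) //= [X in _ + X]big1 ?addr0 => [|l' ll].
        by rewrite -scalerAr -scalerAl mulrA -(mulrA _ _ (x _ _)) !yx !eqxx !scale1r idemM.
      rewrite -scalerAr -scalerAl mulrA -(mulrA _ _ (x _ _)) !yx (negPf ll).
      by rewrite scale0r mulr0 scaler0.
    rewrite mulr_sumr mulr_suml big1 // => m _.
    rewrite -scalerAr -scalerAl mulrA -(mulrA _ _ (x _ _)) !yx eq_sym (negPf kk).
    by rewrite scale0r mul0r scaler0.
  rewrite mulr_sumr mulr_suml big1 // => k' _; rewrite mulr_sumr mulr_suml big1 // => l' _.
  rewrite -scalerAr -scalerAl mulrA -[y i k]mulr1 yx0 ?mul0r ?scaler0 // eq_sym //.
move=> b bM; rewrite -[RHS]mul1r xy1 mulr_suml; apply: eq_bigr => i _.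
rewrite mulr_suml; apply: eq_bigr => k _.
rewrite -[RHS]mulr1 xy1 mulr_sumr (bigD1 i) //= [X in _ + X]big1 ?addr0 => [|j ji].
  rewrite mulr_sumr; apply: eq_bigr => l _.
  by rewrite -(bM i) -!mulrA (mulrA b) (mulrA (y i k)) (mulrA (y i k)) gE -!scalerAl py -scalerAr.
rewrite mulr_sumr big1 // => l _.
by rewrite -!mulrA (mulrA b) (mulrA (y i k)) (mulrA (y i k)) yx0 ?mul0r ?mulr0 // eq_sym.
Qed.

End SplitSemisimple.

(** * Restriction of simple modules along a homomorphism *)

Section Branching.
Variables (K : fieldType) (B C : algType K) (f : {lrmorphism B -> C}).
Variables (I J : finType) (p : I -> B) (q : J -> C) (w : J) (E : pred I).
Hypotheses (sysp : idem_system p) (sysq : idem_system q).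
Hypothesis fpq : forall i, line (f (p i)) (q w) (E i).

Local Notation lv x := (left_ideal_val x).
Local Notation M := (res (left_ideal (q w)) f).

(** The block units [e v] are central in [B] and split the restriction into isotypic parts. The part
    of [v] is 0 or a copy of [B p_v], according to the dimension of [f (p v) C q_w]. *)
Lemma restriction_filtration :
  exists2 vs : seq I,
    has_filtration M (fun v N => isomorphic N (left_ideal (p v))) vs
    & forall v, count_mem v vs = E v.
Proof.
have [e [e1 ep eP]] := idem_central_units sysp.
have e_ortho a u v : u != v -> e u * (a * e v) = 0.
  move=> uv; have [N [x [y [xp _ <-]]]] := eP v.
  rewrite !mulr_sumr big1 // => k _.
  by rewrite -(xp k) (mulrA a) (mulrA a) mulrA ep // mul0r.
have e_comm a v : e v * a = a * e v.
  rewrite -[LHS]mulr1 -[RHS]mul1r e1 mulr_sumr mulr_suml.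
  rewrite (bigD1 v) //= [RHS](bigD1 v) //= mulrA; congr (_ + _).
  rewrite !big1 // => u uv; first by rewrite e_ortho.
  by rewrite -mulrA e_ortho // eq_sym.
have fZ a b : f (a *: b) = a *: f b by rewrite linearZ.
pose act (b : B) (m : M) : C := f b * lv (m : left_ideal (q w)).
have mq (m : M) : lv (m : left_ideal (q w)) * q w = lv (m : left_ideal (q w)).
  exact: left_idealM.
have act1 m : act 1 m = lv (m : left_ideal (q w)) by rewrite /act rmorph1 mul1r.
have actD b a m m' : act b (a *: m + m') = f (b * a) * lv (m : left_ideal (q w)) + act b m'.
  by rewrite /act rmorphM mulrDr -mulrA.
have actE v m : ~~ E v -> act (e v) m = 0.
  move=> Ev; have [N [x [y [_ py <-]]]] := eP v.
  rewrite /act rmorph_sum mulr_suml big1 // => k _.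
  rewrite rmorphM -py rmorphM -mq -!mulrA (mulrA (f (y k))) (mulrA (f (p v))).
  by move: (fpq v); rewrite (negPf Ev) => ->; rewrite mulr0.
(* The filtration is built over a list [l] of blocks: its current term consists of the vectors whose
   components outside [l] vanish. *)
suff H l (F : M -> Prop) : uniq l -> {subset l <= E} ->
    (forall m, F m <-> forall v, v \notin l -> act (e v) m = 0) ->
    filtered (fun v N => isomorphic N (left_ideal (p v))) F l.
  exists (enum E); last by move=> v; rewrite count_uniq_mem ?enum_uniq // mem_enum.
  apply: H; rewrite ?enum_uniq //; first by move=> v; rewrite mem_enum.
  by move=> m; split=> // _ v; rewrite mem_enum => /actE.
elim: l F => [|v l IH] F /=.
  move=> _ _ FE m /FE h; apply: val_inj; rewrite /= -act1 e1.
  by rewrite /act rmorph_sum mulr_suml big1 // => u _; apply: h.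
move=> /andP[vl ul] lE FE.
have : E v by apply: lE; rewrite mem_head.
move=> Ev; have [w0 [w0n w0P w0L]] : line (f (p v)) (q w) true by have := fpq v; rewrite Ev.
have w0q : w0 * q w = w0 by rewrite -w0P -mulrA idemM.
have pw0 : f (p v) * w0 = w0 by rewrite -w0P !mulrA -rmorphM idemM.
have [N [x [y [xp py xy]]]] := eP v.
have inj0 (b : left_ideal (p v)) : f (lv b) * w0 = 0 -> b = 0.
  have [_ /(_ (fun b : left_ideal (p v) => f (lv b) * w0 = 0)) h] := left_ideal_simple sysp v.
  have [||h1] := h.
  - split; first by rewrite rmorph0 mul0r.
    by move=> a b1 b2 h1 h2; rewrite rmorphD rmorphM mulrDl -mulrA h1 h2 mulr0 addr0.
  - by move=> h1; apply: h1.
  by move: (h1 (idem_left sysp v 1)); rewrite /= mul1r pw0 => e0; rewrite e0 eqxx in w0n.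
(* The component of [m] in block [v] is a multiple [f b w0] of the vector [w0] spanning the line;
   [m |-> b] is the quotient map onto [B p_v]. *)
have gex (m : M) : exists b : left_ideal (p v), f (lv b) * w0 = act (e v) m.
  have [c cP] := choice (fun k : 'I_N => w0L (act (y k) m)).
  exists (idem_left sysp v (\sum_k c k *: x k)).
  rewrite /= mulr_suml rmorph_sum -xy /act rmorph_sum !mulr_suml.
  apply: eq_bigr => k _.
  rewrite -scalerAl xp -[X in X * w0]/(f (c k *: x k)) fZ -scalerAl -[x k]xp.
  rewrite !rmorphM -!mulrA pw0 scalerAr.
  by rewrite -cP /act -!mulrA mq.
have [g gP] := choice gex.
have gI m b : f (lv b) * w0 = act (e v) m -> g m = b.
  move=> h; apply/eqP; rewrite -subr_eq0; apply/eqP/inj0.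
  by rewrite rmorphB mulrBl gP h subrr.
exists (fun m => forall u, u \notin l -> act (e u) m = 0); split.
- split.
    by move=> u _; rewrite /act mulr0.
  move=> a m m' hm hm' u ul'; rewrite actD hm' // addr0 e_comm rmorphM -mulrA.
  by rewrite [X in _ * X]hm ?mulr0.
- move=> m h; apply/FE => u; rewrite inE negb_or => /andP[_]; apply: h.
- exists (left_ideal (p v)); first exact: isomorphic_refl.
  exists g; split.
  + move=> a m m' _ _; apply: gI.
    rewrite rmorphD rmorphM mulrDl -mulrA !gP actD; congr (_ + _).
    by rewrite -[RHS]/(act (e v * a) m) e_comm /act rmorphM mulrA.
  + move=> z. 
    have zP : f (lv z) * w0 \in left_ideal_pred (q w) by rewrite inE -mulrA w0q.
    exists (LeftIdeal zP : left_ideal (q w)).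
      apply/FE => u; rewrite inE negb_or => /andP[uv _].
      by rewrite /act /= mulrA -rmorphM -(left_idealM z) ep // rmorph0 mul0r.
    apply: gI; rewrite /act /= mulrA -rmorphM.
    have -> // : e v * lv z = lv z.
    rewrite -[RHS]mul1r e1 mulr_suml (bigD1 v) //= big1 ?addr0 // => u uv.
    by rewrite -(left_idealM z) ep.
  + move=> m /FE Fm; split=> [gm0 u ul'|h].
      have [->|uv] := eqVneq u v; first by rewrite -gP gm0 rmorph0 mul0r.
      by apply: Fm; rewrite inE negb_or uv.
    by apply: gI; rewrite rmorph0 mul0r; symmetry; apply: h.
apply: IH => //; first by move=> u ul'; apply: lE; rewrite inE ul' orbT.

Qed.
End Branching.

Lemma idem_system_branching (K : fieldType) (B : nat -> algType K)
    (f : forall n, {lrmorphism B n -> B n.+1}) (P : pred nat) (L : nat -> finType)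
    (E : forall n, L n -> L n.+1 -> bool) (p : forall n, L n -> B n) :
    (forall n, P n -> idem_system (p n)) ->
    (forall n, P n -> P n.+1 -> forall v w, line (f n (p n v)) (p n.+1 w) (E n v w)) ->
  has_branching_diagram f P L (fun n v w => E n v w).
Proof.
move=> sysp lp; exists (fun n v => left_ideal (p n v)); split=> n Pn.
  split=> [v|v v'|M]; first exact: left_ideal_simple (sysp n Pn) v.
    exact: left_ideal_inj (sysp n Pn) _ _.
  exact: simple_left_ideal (sysp n Pn) _.
move=> Pn1 w; apply: (@restriction_filtration _ _ _ _ _ _ _ _ _ (fun v => E n v w)).
- exact: sysp.
- exact: sysp.
- by move=> v; apply: lp.
Qed.

(** * The basic construction *)

Section TwoSidedIdeal.
Variables (B : nzRingType) (e : B).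
Local Notation J := (two_sided_ideal e).

Lemma two_sided_ideal_gen a b : J (a * e * b).
Proof. by exists [:: (a, b)]; rewrite big_seq1. Qed.

Lemma two_sided_ideal_sum (T : Type) (s : seq T) (P : pred T) (g : T -> B) :
  (forall t, J (g t)) -> J (\sum_(t <- s | P t) g t).
Proof.
move=> gJ; apply: big_ind => //; first by exists [::]; rewrite big_nil.
by move=> _ _ [s1 ->] [s2 ->]; exists (s1 ++ s2); rewrite big_cat.
Qed.

Lemma two_sided_idealMl a b : J b -> J (a * b).
Proof.
case=> s ->; rewrite mulr_sumr; apply: two_sided_ideal_sum => t.
by rewrite !mulrA; apply: two_sided_ideal_gen.
Qed.

Lemma two_sided_idealMr a b : J b -> J (b * a).
Proof.
case=> s ->; rewrite mulr_suml; apply: two_sided_ideal_sum => t.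
by rewrite -mulrA; apply: two_sided_ideal_gen.
Qed.

End TwoSidedIdeal.

(** * The ideal generated by the Jones idempotent, its unit, and its complement *)

Section BasicConstruction.
Variables (K : fieldType) (B0 B1 B2 : algType K).
Variables (f0 : {lrmorphism B0 -> B1}) (f1 : {lrmorphism B1 -> B2}).
Variables (e : B2) (E : B1 -> B0) (r : B2 -> B1) (tr : {scalar B1}) (inv : B2 -> B2).
Hypotheses (ee : e * e = e) (e_comm : forall x, e * f1 (f0 x) = f1 (f0 x) * e).
Hypothesis eEe : forall x, e * f1 x * e = f1 (f0 (E x)) * e.
Hypothesis rP : forall b, b * e = f1 (r b) * e.
Hypothesis f1e_inj : forall x, f1 x * e = 0 -> x = 0.
Hypothesis f0_inj : forall x, f0 x = 0 -> x = 0.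
Hypothesis trC : forall x y, tr (x * y) = tr (y * x).
Hypothesis tr_nondeg : forall x, x != 0 -> exists y, tr (x * y) != 0.
Hypothesis tr_E : forall x, E x = 0 -> tr x = 0.
Hypotheses (invD : forall x y, inv (x + y) = inv x + inv y)
  (invM : forall x y, inv (x * y) = inv y * inv x) (invK : involutive inv).
Hypothesis inv_e : two_sided_ideal e (inv e).
Variables (I0 I1 : finType) (p0 : I0 -> B0) (p1 : I1 -> B1) (D : I0 -> I1 -> bool).
Hypotheses (sys0 : idem_system p0) (sys1 : idem_system p1).
Hypothesis lineD : forall i j, line (f0 (p0 i)) (p1 j) (D i j).

Let fe_inj x : f1 (f0 x) * e = 0 -> x = 0.
Proof. by move/f1e_inj/f0_inj. Qed.

Let fe_inj2 x y : f1 (f0 x) * e = f1 (f0 y) * e -> x = y.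
Proof.
move=> h; apply/eqP; rewrite -subr_eq0; apply/eqP/fe_inj.
by rewrite !rmorphB mulrBl h subrr.
Qed.

(** Both sides may be compared after embedding and multiplying by [e], which is injective on [B0];
    there [a] and [b] pass through [e]. *)
Lemma expectationM a x b : E (f0 a * x * f0 b) = a * E x * b.
Proof.
apply: fe_inj2; rewrite -eEe !rmorphM -!mulrA -e_comm !mulrA e_comm.
by rewrite -!mulrA (mulrA e) (mulrA (e * _)) eEe -!mulrA e_comm.
Qed.

Lemma expectationZ c x : E (c *: x) = c *: E x.
Proof.
apply: fe_inj2; rewrite -eEe !linearZ /= -scalerAr -!scalerAl eEe //.
Qed.

(* Dimension at most one is inherited by p1 j B1 p0 i because the trace pairs it faithfully with
   p0 i B1 p1 j. *)
Lemma line_sym i j : line (p1 j) (f0 (p0 i)) (D i j).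
Proof.
have tr_dual (x : B1) : p1 j * x * f0 (p0 i) = x -> x != 0 ->
    exists y, tr (f0 (p0 i) * y * p1 j * x) != 0.
  move=> xP /tr_nondeg[y]; rewrite -{1}xP => h; exists y; move: h.
  by rewrite -!mulrA trC -!mulrA trC -!mulrA trC -!mulrA.
have pp := idemM sys0 i; have qq := idemM sys1 j.
have := lineD i j; case: (D i j) => /= [[w [w0 wP wL]]|h b]; last first.
  have [//|/eqP /tr_dual] := EM (p1 j * b * f0 (p0 i) = 0).
  case=> [|y]; last by rewrite h mul0r linear0 eqxx.
  by rewrite !mulrA qq -!mulrA -rmorphM pp.
have [x xw] := tr_nondeg w0.
pose w' := p1 j * x * f0 (p0 i).
have w'P : p1 j * w' * f0 (p0 i) = w' by rewrite /w' !mulrA qq -!mulrA -rmorphM pp.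
have tr_ww' : tr (w * w') != 0.
  suff -> : tr (w * w') = tr (w * x) by [].
  rewrite /w' !mulrA -wP -[_ * p1 j * p1 j]mulrA qq wP trC -wP !mulrA.
  by rewrite -rmorphM pp.
exists w'; split=> //.
  by apply: contraNneq tr_ww' => ->; rewrite mulr0 linear0.
move=> b; set y := p1 j * b * f0 (p0 i).
have yP : p1 j * y * f0 (p0 i) = y by rewrite /y !mulrA qq -!mulrA -rmorphM pp.
(* Subtracting this multiple of [w'] from [y] makes the difference orthogonal to [w], hence to the
   whole line that the trace pairs with it, hence 0. *)
exists (tr (w * y) / tr (w * w')); apply/eqP; rewrite -subr_eq0; apply: contraT => nz.
have [|u] := tr_dual _ _ nz; first by rewrite mulrBr mulrBl -scalerAr -scalerAl yP w'P.
have [c ->] := wL u; rewrite -scalerAl linearZ mulrBr linearB /= -scalerAr linearZ /=.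
by rewrite divfK // subrr mulr0 eqxx.
Qed.

(** With [w] spanning [p1 j B1 p0 i] and [w'] dual to it under [E], the map [b |-> w E (w' b)] is
    the identity on this corner. The zero pair serves when the corner is 0. *)
Lemma corner_projection i j : exists ww' : B1 * B1,
  [/\ ww'.1 * f0 (p0 i) = ww'.1, f0 (p0 i) * ww'.2 = ww'.2
    & forall b, ww'.1 * f0 (E (ww'.2 * b * f0 (p0 i))) = p1 j * b * f0 (p0 i)].
Proof.
have pp := idemM sys0 i; have qq := idemM sys1 j.
have := line_sym i j; case: (D i j) => /= [[w [w0 wP wL]]|ls]; last first.
  exists (0, 0); split=> [||b] /=; rewrite ?mul0r ?mulr0 //.
have wp : w * f0 (p0 i) = w by rewrite -wP -mulrA -rmorphM pp.
have qw : p1 j * w = w by rewrite -wP !mulrA qq.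
have [y yw] := tr_nondeg w0.
pose w1 := f0 (p0 i) * y * p1 j.
have w1w : w1 * w = f0 (p0 i) * (y * w) * f0 (p0 i).
  by rewrite /w1 -[LHS]mulrA qw -{1}wp !mulrA.
have [c cP] := idem_scalar sys0 i (E (y * w)).
have Ec : E (w1 * w) = c *: p0 i by rewrite w1w expectationM.
(* The trace factors through [E], so [c = 0] would force [tr (w1 w) = tr (y w)] to vanish, against
   the choice of [y]. *)
have c0 : c != 0.
  apply: contra_neq yw => c0; move: Ec; rewrite c0 scale0r => /tr_E.
  rewrite (trC w) => <-; rewrite w1w [RHS]trC mulrA -rmorphM pp [RHS]trC.
  by rewrite -mulrA wp.
exists (w, c^-1 *: w1); split=> //= [|b].
  by rewrite -scalerAr /w1 !mulrA -rmorphM pp.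
have [d dP] := wL b; rewrite dP.
have -> : c^-1 *: w1 * b * f0 (p0 i) = (c^-1 * d) *: (w1 * w).
  rewrite -!scalerAl -scalerA; congr (_ *: _).
  by rewrite scalerAr -dP /w1 !mulrA -(mulrA _ (p1 j) (p1 j)) qq.
rewrite expectationZ Ec scalerA mulrAC mulVf // mul1r linearZ /= -scalerAr wp //.
Qed.

(** Left multiplication on the ideal only sees [B2 e = B1 e], which is spanned by the
    [f1 (a p0_i) e] times elements of [B0]. There the [i]-th part of [u] reassembles
    [1 = sum x p1_j y] by [corner_projection]. *)
Lemma ideal_left_unit : exists2 u, two_sided_ideal e u &
  forall b, two_sided_ideal e b -> u * b = b.
Proof.
have [ww wwP] := choice (fun ij : I0 * I1 => corner_projection ij.1 ij.2).
have [s1 s1P] : exists s, 1 = \sum_(t <- s) t.2.1 * p1 t.1 * t.2.2 by case: sys1.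
have [s0 s0P] : exists s, 1 = \sum_(t <- s) t.2.1 * p0 t.1 * t.2.2 by case: sys0.
pose u := \sum_i \sum_(t <- s1)
  f1 (t.2.1 * (ww (i, t.1)).1) * e * f1 ((ww (i, t.1)).2 * t.2.2).
exists u.
  by do 2![apply: two_sided_ideal_sum => ?]; apply: two_sided_ideal_gen.
have aux X Y Z : f1 X * e * f1 Y * (f1 Z * e) = f1 (X * f0 (E (Y * Z))) * e.
  by rewrite -!mulrA (mulrA (f1 Y)) -rmorphM (mulrA e) eEe mulrA -rmorphM.
(* Only the index [i] contributes: for [k] distinct from [i], the expectation produces an element of
   [p0_k B0 p0_i], which is 0. *)
have u_col i a : u * (f1 (a * f0 (p0 i)) * e) = f1 (a * f0 (p0 i)) * e.
  have uE k t : f1 (t.2.1 * (ww (k, t.1)).1) * e * f1 ((ww (k, t.1)).2 * t.2.2) *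
      (f1 (a * f0 (p0 i)) * e) =
      f1 (t.2.1 * ((ww (k, t.1)).1 *
        f0 (E ((ww (k, t.1)).2 * (t.2.2 * a) * f0 (p0 i))))) * e.
    by rewrite aux !mulrA.
  rewrite mulr_suml (bigD1 i) //= [X in _ + X]big1 ?addr0 => [|k ki].
    rewrite mulr_suml; under eq_bigr => t _.
      rewrite uE; have [_ _ ->] := wwP (i, t.1); rewrite /= !mulrA.
      over.
    by rewrite -mulr_suml -rmorph_sum -!mulr_suml -s1P mul1r.
  rewrite mulr_suml big1 // => t _; rewrite uE; have [_ <- _] := wwP (k, t.1).
  by rewrite /= -(mulrA (f0 (p0 k))) expectationM idem_ortho // rmorph0 !mulr0 rmorph0 mul0r.
have u_A a : u * (f1 a * e) = f1 a * e.
  have -> : f1 a * e = \sum_(t <- s0) f1 (a * f0 t.2.1 * f0 (p0 t.1)) * e * f1 (f0 t.2.2).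
    rewrite -[a in LHS]mulr1 -(rmorph1 f0) s0P rmorph_sum mulr_sumr rmorph_sum mulr_suml.
    by apply: eq_bigr => t _; rewrite -[RHS]mulrA e_comm !rmorphM !mulrA.
  by rewrite mulr_sumr; apply: eq_bigr => t _; rewrite mulrA u_col.
move=> _ [s ->]; rewrite mulr_sumr; apply: eq_bigr => t _.
by rewrite mulrA rP u_A.
Qed.

(** The involution preserves the ideal, so [inv u] is a right unit and equals the left unit [u].
    Both [u b] and [b u] lie in the ideal, hence equal [u b u], and [u] is central. *)
Lemma ideal_unit : exists z, [/\ two_sided_ideal e z,
  forall b, two_sided_ideal e b -> z * b = b,
  forall b, two_sided_ideal e b -> b * z = b & forall b, z * b = b * z].
Proof.
have invJ b : two_sided_ideal e b -> two_sided_ideal e (inv b).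
  have inv0 : inv 0 = 0 by apply: (addrI (inv 0)); rewrite -invD !addr0.
  case=> s ->; rewrite (big_morph inv invD inv0); apply: two_sided_ideal_sum => t.
  by rewrite !invM; apply: two_sided_idealMl; apply: two_sided_idealMr.
have [u uJ uP] := ideal_left_unit.
have Pu b : two_sided_ideal e b -> b * inv u = b.
  by move=> bJ; apply: (can_inj invK); rewrite invM invK uP //; apply: invJ.
have eu : inv u = u by rewrite -[RHS]Pu // uP //; apply: invJ.
rewrite eu in Pu; exists u; split=> // b.
have <- : u * b * u = u * b by rewrite Pu //; apply: two_sided_idealMr.
by rewrite -mulrA uP //; apply: two_sided_idealMl.
Qed.

Variables (C1 C : algType K) (fQ : {lrmorphism C1 -> C}).
Variables (pi1 : {lrmorphism B1 -> C1}) (pi2 : {lrmorphism B2 -> C}).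
Hypothesis pi_f : forall x, pi2 (f1 x) = fQ (pi1 x).
Hypothesis pi_e : pi2 e = 0.
(** Together with [pi_ext], this describes [C] as the quotient of [B2] by the ideal in terms of
    linear maps, a form that passes to specializations. *)
Hypothesis pi_factor : forall h : {linear B2 -> B2},
  (forall b, two_sided_ideal e b -> h b = 0) ->
  exists s : {linear C -> B2}, forall b, s (pi2 b) = h b.
Hypothesis pi_ext : forall g g' : {linear C -> C},
  (forall b, g (pi2 b) = g' (pi2 b)) -> g =1 g'.
Variables (IQ : finType) (q : IQ -> C) (DQ : I1 -> IQ -> bool).
Hypothesis sysq : idem_system q.
Hypothesis lineDQ : forall j w, line (fQ (pi1 (p1 j))) (q w) (DQ j w).

Let pi_J b : two_sided_ideal e b -> pi2 b = 0.
Proof.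
have pi_aeb x y : pi2 (x * e * y) = 0 by rewrite !rmorphM /= pi_e mulr0 mul0r.
by case=> s ->; rewrite rmorph_sum big1 // => t _; apply: pi_aeb.
Qed.

(** The central unit [z] splits [B2] into the ideal and [(1 - z) B2], a copy of [C]. In the ideal
    the corner of [e] is [B0 e], so the system of [B0] times [e] serves there; the system of [C] is
    lifted to the other factor. *)
Lemma basic_construction : exists p2 : I0 + IQ -> B2,
  [/\ idem_system p2, forall j i, line (f1 (p1 j)) (p2 (inl i)) (D i j),
      forall j w, line (f1 (p1 j)) (p2 (inr w)) (DQ j w),
      forall i, pi2 (p2 (inl i)) = 0
    & forall w, pi2 (p2 (inr w)) = q w].
Proof.
have [z [zJ zl zr zC]] := ideal_unit.
have hL : linear (fun b => b * (1 - z)) by move=> c x y; rewrite mulrDl scalerAl.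
pose h : {linear B2 -> B2} :=
  HB.pack (fun b => b * (1 - z)) (GRing.isLinear.Build _ _ _ _ (fun b => b * (1 - z)) hL).
(* Multiplication by [1 - z] kills the ideal, so it descends to a map [s] on [C]: the multiplicative
   section of [pi2] with values in [(1 - z) B2]. *)
have [|s sP] := pi_factor (h := h).
  by move=> b bJ; rewrite /h /= mulrBr mulr1 zr // subrr.
have {}sP b : s (pi2 b) = b * (1 - z) by rewrite sP.
have piz : pi2 (1 - z) = 1 by rewrite rmorphB rmorph1 /= pi_J // subr0.
have piK c : pi2 (s c) = c.
  apply: (@pi_ext (pi2 \o s) idfun) => b /=.
  by rewrite sP rmorphM /= piz mulr1.
have zz : (1 - z) * (1 - z) = 1 - z.
  by rewrite mulrBr mulr1 mulrBl mul1r zr // subrr subr0.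
have sz c : s c * (1 - z) = s c by rewrite -[c]piK sP -mulrA zz.
have z1C b : b * (1 - z) = (1 - z) * b by rewrite mulrBr mulrBl mulr1 mul1r zC.
have bs b c : b * s c = s (pi2 b * c).
  by rewrite -{2}[c]piK -rmorphM sP -mulrA sz.
have sb b c : s c * b = s (c * pi2 b).
  by rewrite -{2}[c]piK -rmorphM sP -mulrA z1C mulrA sz.
have i0e x : f1 (f0 x) * e = e * f1 (f0 x) by rewrite e_comm.
have ebe b : e * b * e = f1 (f0 (E (r b))) * e by rewrite -mulrA rP mulrA eEe.
pose p2 t : B2 := match t with inl i => f1 (f0 (p0 i)) * e | inr w => s (q w) end.
have p0bp0 i i' b : f1 (f0 (p0 i)) * e * b * (f1 (f0 (p0 i')) * e) =
    f1 (f0 (p0 i * E (r b) * p0 i')) * e.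
  rewrite (i0e (p0 i')) mulrA -(mulrA _ e b) -(mulrA _ (e * b)) ebe.
  by rewrite mulrA -mulrA -i0e mulrA -!rmorphM.
exists p2; split=> [|j i|j w|i|w] /=.
- split.
  + case=> [i|w] /=.
      by apply: contra_neq (idem_neq0 sys0 i) => /fe_inj.
    by apply: contra_neq (idem_neq0 sysq w) => h0; rewrite -(piK (q w)) h0 rmorph0.
  + case=> [i|w] /=; last by rewrite sb piK idemM.
    by rewrite -mulrA (mulrA e) -i0e !mulrA -!rmorphM idemM // -mulrA ee.
  + case=> [i|w] b /=.
      have [c cP] := idem_scalar sys0 i (E (r b)); exists c.
      by rewrite p0bp0 cP !linearZ /= -scalerAl.
    have [c cP] := idem_scalar sysq w (pi2 b); exists c.
    by rewrite sb sb piK cP linearZ.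
  + case=> [i|w] [i'|w'] b //= ne.
    * by rewrite p0bp0 idem_ortho ?rmorph0 ?mul0r //; apply: contraNneq ne => ->.
    * by rewrite bs !rmorphM /= pi_e mulr0 !mul0r linear0.
    * by rewrite sb sb !rmorphM /= pi_e !mulr0 linear0.
    * by rewrite sb sb piK idem_ortho ?linear0 //; apply: contraNneq ne => ->.
  + have [s0 s0P] : exists s, 1 = \sum_(t <- s) t.2.1 * p0 t.1 * t.2.2 by case: sys0.
    have [sq sqP] : exists s, 1 = \sum_(t <- s) t.2.1 * q t.1 * t.2.2 by case: sysq.
    have [sz0 szP] := zJ.
    exists ([seq (inl t.1, (a.1 * f1 (f0 t.2.1), f1 (f0 t.2.2) * a.2)) | a <- sz0, t <- s0] ++
      [seq (inr t.1, (s t.2.1, s t.2.2)) | t <- sq]).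
    (* Decompose [1 = z + (1 - z)]: in [z = sum a e b] insert the decomposition of the unit of [B0]
       next to [e], and apply [s] to that of the unit of [C]. *)
    rewrite big_cat big_map big_allpairs_dep /= -{1}(subrK z 1) [LHS]addrC; congr (_ + _).
      rewrite szP; apply: eq_bigr => a _.
      rewrite -[e in LHS]mul1r -(rmorph1 f1) -(rmorph1 f0) s0P !rmorph_sum /=.
      rewrite mulr_suml mulr_sumr mulr_suml; apply: eq_bigr => t _.
      by rewrite !rmorphM -!mulrA (mulrA e) e_comm !mulrA.
    have -> : 1 - z = s 1 by rewrite -(rmorph1 pi2) sP mul1r.
    rewrite sqP linear_sum; apply: eq_bigr => t _ /=.
    by rewrite sb sb !piK.
(* The new corner is [p1 j B1 p0 i] times [e], the old line read backwards; this is where the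
   diagram is reflected. *)
- have eq0 b : f1 (p1 j) * b * (f1 (f0 (p0 i)) * e) = f1 (p1 j * r b * f0 (p0 i)) * e.
    by rewrite i0e mulrA -(mulrA _ b) rP -!mulrA -i0e !mulrA -!rmorphM.
  have := line_sym i j; case: (D i j) => /= [[w [w0 wP wL]]|ls b]; last first.
    by rewrite eq0 ls rmorph0 mul0r.
  exists (f1 w * e); split=> [||b].
  + by apply: contra_neq w0 => /f1e_inj.
  + by rewrite i0e !mulrA -(mulrA _ e e) ee -(mulrA _ e) -i0e !mulrA -!rmorphM wP.
  + by have [c cP] := wL (r b); exists c; rewrite eq0 cP linearZ /= scalerAl.
- have eq0 b : f1 (p1 j) * b * s (q w) = s (fQ (pi1 (p1 j)) * pi2 b * q w).
    by rewrite bs rmorphM /= pi_f.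
  have := lineDQ j w; case: (DQ j w) => /= [[x [x0 xP xL]]|lq b]; last first.
    by rewrite eq0 lq linear0.
  exists (s x); split=> [||b].
  + by apply: contra_neq x0 => h0; rewrite -(piK x) h0 rmorph0.
  + by rewrite eq0 piK xP.
  + by have [c cP] := xL (pi2 b); exists c; rewrite eq0 cP linearZ.
- by rewrite rmorphM /= pi_e mulr0.
- exact: piK.
Qed.

End BasicConstruction.

(** * Base change and cell representations *)

Section BaseChange.
Variables (R : idomainType) (K : fieldType) (rho : {rmorphism R -> K}).
Variables (A : algType R) (B : algType K) (phi : {rmorphism A -> B}).
Hypothesis bc : is_base_change rho phi.

Lemma base_changeZ r x : phi (r *: x) = rho r *: phi x.
Proof. by case: bc. Qed.

(** The uniqueness half of the universal property. Identities valid in [A] are carried over to [B]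
    through it, one variable at a time. *)
Lemma base_change_ext (V : lmodType K) (g g' : B -> V) :
  linear g -> linear g' -> (forall x, g (phi x) = g' (phi x)) -> g =1 g'.
Proof.
move=> gL gL' gg'; have [_ uni] := bc.
have fA : zmod_morphism (g \o phi).
  move=> x y /=; rewrite rmorphB -[LHS]/(g (phi x + - phi y)) addrC -scaleN1r gL scaleN1r.
  by rewrite addrC.
pose f : {additive A -> V} := HB.pack (g \o phi) (GRing.isZmodMorphism.Build _ _ (g \o phi) fA).
have g0 : g 0 = 0 by have := gL 1 0 0; rewrite scaler0 scale1r add0r -[X in X = _]addr0 => /addrI.
have fZ r x : f (r *: x) = rho r *: f x.
  by rewrite /f /= base_changeZ -[_ *: phi x]addr0 gL g0 addr0.
have [h [_ hu]] := uni V f fZ.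
pose G : {linear B -> V} := HB.pack g (GRing.isLinear.Build _ _ _ _ g gL).
pose G' : {linear B -> V} := HB.pack g' (GRing.isLinear.Build _ _ _ _ g' gL').
move=> b; rewrite -[LHS]/(G b) -[RHS]/(G' b).
by rewrite !hu // => x; rewrite /G /G' /= -gg'.
Qed.

Lemma base_change_fun (V : lmodType K) (f : A -> V) :
  (forall r x y, f (r *: x + y) = rho r *: f x + f y) ->
  exists g : {linear B -> V}, forall x, g (phi x) = f x.
Proof.
move=> fL; have [_ uni] := bc.
have fA : zmod_morphism f.
  by move=> x y; rewrite addrC -scaleN1r fL rmorphN1 scaleN1r addrC.
pose F : {additive A -> V} := HB.pack f (GRing.isZmodMorphism.Build _ _ f fA).
have f0 : f 0 = 0 by rewrite -(subrr 0) fA subrr.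
have [|g [gP _]] := uni V F.
  by move=> r x; rewrite /F /= -[_ *: x]addr0 fL f0 addr0.
by exists g.
Qed.

(** Multiplicativity on the image of [phi] extends to [B] by linearity, first in one factor and then
    in the other. *)
Lemma base_change_lrmorphism (C : algType K) (f : {linear B -> C}) :
  f 1 = 1 -> (forall x y, f (phi x * phi y) = f (phi x) * f (phi y)) ->
  exists g : {lrmorphism B -> C}, g =1 f.
Proof.
move=> f1 fM.
have fMl x : forall b, f (phi x * b) = f (phi x) * f b.
  apply: base_change_ext => [c b b'|c b b'|y]; rewrite ?fM //.
    by rewrite mulrDr -scalerAr linearP.
  by rewrite linearP mulrDr scalerAr.
have {}fM : monoid_morphism f.
  split=> // a b; move: a; apply: base_change_ext => [c a a'|c a a'|y]; rewrite ?fMl //.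
    by rewrite mulrDl -scalerAl linearP.
  by rewrite linearP mulrDl scalerAl.
pose g : {lrmorphism B -> C} :=
  HB.pack (f : B -> C) (GRing.Linear.on (f : B -> C)) (GRing.isMonoidMorphism.Build _ _ f fM).
by exists g.
Qed.

End BaseChange.

Section FiniteBasis.
Variables (R : nzRingType) (M : lmodType R) (I : choiceType) (b : I -> M).
Variables (J : finType) (h : J -> I) (k : I -> J).
Hypotheses (hK : cancel h k) (kK : cancel k h).

Lemma lincomb_finite (u : {fsfun I -> R with 0}) : lincomb b u = \sum_j u (h j) *: b (h j).
Proof.
rewrite /lincomb -(big_map h predT (fun i => u i *: b i)) /=.
rewrite [RHS](bigID (mem (finsupp u))) /= [X in _ + X]big1 ?addr0 => [|i]; last first.
  by move=> /fsfun_dflt ->; rewrite scale0r.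
rewrite -[RHS]big_filter; apply: perm_big; apply: uniq_perm => [||i].
- exact: fset_uniq.
- by rewrite filter_uniq // map_inj_uniq ?index_enum_uniq //; apply: can_inj hK.
rewrite mem_filter; case: (boolP (i \in finsupp u)) => //= _.
by symmetry; apply/mapP; exists (k i); rewrite ?mem_index_enum ?kK.
Qed.

Lemma fsfun_finite (f : J -> R) : exists u : {fsfun I -> R with 0}, forall j, u (h j) = f j.
Proof.
exists [fsfun i in [fset h j | j in J]%fset => f (k i)] => j.
by rewrite fsfunE hK; case: imfsetP => // [[]]; exists j.
Qed.

Lemma finite_is_basis (co : M -> J -> R) :
    (forall x, x = \sum_j co x j *: b (h j)) ->
    (forall u : J -> R, co (\sum_j u j *: b (h j)) =1 u) ->
  is_basis b.
Proof.
move=> coE coK x; have [u uE] := fsfun_finite (co x); exists u; split.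
  by rewrite lincomb_finite [RHS]coE; apply: eq_bigr => j _; rewrite uE.
move=> v; rewrite lincomb_finite => vx; apply/fsfunP => i.
by rewrite -[i]kK uE -vx coK.
Qed.

Lemma finite_basis : is_basis b ->
  exists co : M -> J -> R,
    (forall x, x = \sum_j co x j *: b (h j)) /\
    (forall u : J -> R, co (\sum_j u j *: b (h j)) =1 u).
Proof.
move=> bB; have [co coP] := choice bB.
exists (fun x j => co x (h j)); split=> [x|u j].
  by rewrite -(lincomb_finite (co x)); case: (coP x).
have [_ uni] := coP (\sum_j u j *: b (h j)).
have [u' u'E] := fsfun_finite u.
rewrite (uni u') ?u'E //.
by rewrite lincomb_finite; apply: eq_bigr => i _; rewrite u'E.
Qed.

End FiniteBasis.

(** * Matrix representations on cell modules and their specializations *)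

Section CellRepresentation.
Variables (R : idomainType) (A : algType R) (inv : A -> A) (d : Order.disp_t).
Variables (L : finPOrderType d) (D : cell_datum inv L) (dim : L -> nat).
Variables (en : forall l, 'I_(dim l) -> cell_T D l) (de : forall l, cell_T D l -> 'I_(dim l)).
Hypotheses (enK : forall l, cancel (en (l := l)) (de (l := l)))
  (deK : forall l, cancel (de (l := l)) (en (l := l))).

Local Notation Ix := {l : L & ('I_(dim l) * 'I_(dim l))%type}.
Local Notation cI := {l : L & (cell_T D l * cell_T D l)%type}.

Definition cell_ix l i j : Ix := existT _ l (i, j).

Lemma cell_ix_eq l (i j i' j' : 'I_(dim l)) :
  (cell_ix i j == cell_ix i' j') = (i == i') && (j == j').
Proof. by rewrite -tag_eqE /tag_eq /= eqxx tagged_asE. Qed.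

Let ixE (x : Ix) : cI := existT _ (tag x) (en (tagged x).1, en (tagged x).2).
Let ixD (x : cI) : Ix := existT _ (tag x) (de (tagged x).1, de (tagged x).2).
Let ixEK : cancel ixE ixD. Proof. by case=> l [i j]; rewrite /ixE /ixD /= !enK. Qed.
Let ixDK : cancel ixD ixE. Proof. by case=> l [i j]; rewrite /ixE /ixD /= !deK. Qed.

Definition cell_vec (x : Ix) : A := cell_c (en (tagged x).1) (en (tagged x).2).

Fact cell_coord_subproof : exists co : A -> Ix -> R,
    (forall x, x = \sum_j co x j *: cell_vec j) /\
    (forall u : Ix -> R, co (\sum_j u j *: cell_vec j) =1 u).
Proof. exact: (finite_basis ixEK ixDK (cell_basis D)). Qed.

Definition cell_coord : A -> Ix -> R := projT1 (cid cell_coord_subproof).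

Lemma cell_coordE x : x = \sum_j cell_coord x j *: cell_vec j.
Proof. by rewrite /cell_coord; case: cid => co /= []. Qed.

Lemma cell_coord_sum u : cell_coord (\sum_j u j *: cell_vec j) =1 u.
Proof. by rewrite /cell_coord; case: cid => co /= []. Qed.

Lemma cell_coordP c x y j :
  cell_coord (c *: x + y) j = c * cell_coord x j + cell_coord y j.
Proof.
rewrite {1}(cell_coordE x) {1}(cell_coordE y) scaler_sumr -big_split /=.
under eq_bigr do rewrite scalerA -scalerDl.
exact: cell_coord_sum.
Qed.

Lemma cell_coord0 j : cell_coord 0 j = 0.
Proof. by have := cell_coordP (-1) 0 0 j; rewrite scaler0 addr0 mulN1r addNr. Qed.

Lemma cell_coordD x y j : cell_coord (x + y) j = cell_coord x j + cell_coord y j.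
Proof. by rewrite -[x in LHS]scale1r cell_coordP mul1r. Qed.

Lemma cell_coordZ c x j : cell_coord (c *: x) j = c * cell_coord x j.
Proof. by rewrite -[X in cell_coord X]addr0 cell_coordP cell_coord0 addr0. Qed.

Lemma cell_coord_bigsum (T : finType) (F : T -> A) j :
  cell_coord (\sum_t F t) j = \sum_t cell_coord (F t) j.
Proof.
exact: (big_morph (cell_coord^~ j) (fun x y => cell_coordD x y j) (cell_coord0 j)).
Qed.

Lemma cell_coord_vec x j : cell_coord (cell_vec x) j = (j == x)%:R.
Proof.
rewrite -[RHS](cell_coord_sum (fun j => (j == x)%:R)) (bigD1 x) //= eqxx scale1r.
by rewrite big1 ?addr0 // => y /negPf ->; rewrite scale0r.
Qed.

Lemma cell_coord_span (P : L -> Prop) x j :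
  in_span (cell_elt (@cell_c _ _ _ _ _ D)) (fun i => P (tag i)) x ->
  ~ P (tag j) -> cell_coord x j = 0.
Proof.
case=> u uP <- Pj; rewrite (lincomb_finite _ ixEK ixDK) [LHS]cell_coord_sum.
case: finsuppP => // /uP; by case: j Pj.
Qed.

(** The matrix of [a] on the cell module of [l], acting on column vectors in the basis numbered by
    [en]. *)
Definition cell_rep l (a : A) : 'M[R]_(dim l) :=
  \matrix_(m, i) cell_r a (en i) (en m).

Lemma cell_vecM a l i j x : ~~ (l < tag x)%O ->
  cell_coord (a * cell_vec (cell_ix i j)) x =
  \sum_m cell_rep l a m i * (x == cell_ix m j)%:R.
Proof.
move=> lx; have := cell_mul a (en i) (en j).
rewrite (lincomb_finite _ (enK (l := l)) (deK (l := l))).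
move=> /(@cell_coord_span (fun m => (l < m)%O)) /(_ (elimN idP lx)).
rewrite addrC -scaleN1r cell_coordP mulN1r addrC => /eqP; rewrite subr_eq0 => /eqP ->.
rewrite cell_coord_bigsum; apply: eq_bigr => m _.
by rewrite cell_coordZ -(cell_coord_vec (cell_ix m j)) mxE.
Qed.

(** Exhibits the coefficients [r] as coordinates in the cell basis, whence their linearity and
    multiplicativity. The auxiliary index [j] is free, so the column index [i] can always be taken
    for it. *)
Lemma cell_repE l a m i j :
  cell_rep l a m i = cell_coord (a * cell_vec (cell_ix i j)) (cell_ix m j).
Proof.
rewrite cell_vecM ?ltxx // (bigD1 m) //= eqxx mulr1 big1 ?addr0 // => n nm.
by rewrite cell_ix_eq eq_sym (negPf nm) mulr0.
Qed.

Lemma cell_repP l : linear (cell_rep l).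
Proof.
move=> c x y; apply/matrixP=> m i.
by rewrite [RHS]mxE [X in _ = X + _]mxE !(cell_repE _ _ _ i) mulrDl -scalerAl cell_coordP.
Qed.

Lemma cell_rep1 l : cell_rep l 1 = 1%:M.
Proof.
apply/matrixP=> m i; rewrite (cell_repE _ _ _ i) mul1r cell_coord_vec mxE.
by rewrite cell_ix_eq eqxx andbT.
Qed.

Lemma cell_repM l a b : cell_rep l (a * b) = cell_rep l a *m cell_rep l b.
Proof.
apply/matrixP=> m i; rewrite (cell_repE _ _ _ i) mxE.
rewrite -mulrA [b * _]cell_coordE mulr_sumr cell_coord_bigsum.
(* Expand [b c_(i,i)] in the cell basis. Cells above [l] stay above [l] under multiplication by [a],
   so only the terms at [(n, i)] in the cell [l] count. *)
have termE x :
    cell_coord (a * (cell_coord (b * cell_vec (cell_ix i i)) x *: cell_vec x)) (cell_ix m i) =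
    \sum_n cell_rep l b n i * (x == cell_ix n i)%:R * cell_coord (a * cell_vec x) (cell_ix m i).
  rewrite -scalerAr cell_coordZ -mulr_suml.
  have [lx|lx] := boolP (l < tag x)%O; last by rewrite cell_vecM.
  have -> : cell_coord (a * cell_vec x) (cell_ix m i) = 0; last by rewrite !mulr0.
  case: x lx => l' [i' j'] lx; rewrite [LHS](@cell_vecM a l' i' j').
    by rewrite big1 // => n _; rewrite -tag_eqE /tag_eq /= (lt_eqF lx) mulr0.
  by rewrite lt_gtF.
under eq_bigr do rewrite termE.
rewrite exchange_big; apply: eq_bigr => n _ /=.
rewrite (bigD1 (cell_ix n i)) //= big1 ?addr0 => [|x /negPf ->]; last by rewrite mulr0 mul0r.
by rewrite eqxx mulr1 mulrC -cell_repE.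
Qed.

Variables (K : fieldType) (rho : {rmorphism R -> K}) (B : algType K).
Variable phi : {rmorphism A -> B}.
Hypothesis bc : is_base_change rho phi.

Fact cell_repK_subproof l : exists g : {linear B -> 'M[K]_(dim l)},
  forall a, g (phi a) = map_mx rho (cell_rep l a).
Proof.
apply: (base_change_fun bc) => r x y.
by rewrite cell_repP map_mxD map_mxZ.
Qed.

Definition cell_repK l := projT1 (cid (cell_repK_subproof l)).

Lemma cell_repK_map l a : cell_repK l (phi a) = map_mx rho (cell_rep l a).
Proof. by rewrite /cell_repK; case: cid. Qed.

Lemma cell_repK1 l : cell_repK l 1 = 1%:M.
Proof. by rewrite -(rmorph1 phi) cell_repK_map cell_rep1 map_mx1. Qed.

Lemma cell_repKM l a b : cell_repK l (a * b) = cell_repK l a *m cell_repK l b.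
Proof.
move: a; apply: (base_change_ext bc) => [c x y|c x y|x].
- by rewrite mulrDl -scalerAl linearP.
- by rewrite linearP mulmxDl scalemxAl.
move: b; apply: (base_change_ext bc) => [c y z|c y z|y].
- by rewrite mulrDr -scalerAr linearP.
- by rewrite linearP mulmxDr scalemxAr.
by rewrite -rmorphM !cell_repK_map cell_repM map_mxM.
Qed.

Fact cell_coordK_subproof : exists g : {linear B -> {ffun Ix -> K^o}},
  forall a, g (phi a) = [ffun x => rho (cell_coord a x)].
Proof.
apply: (base_change_fun bc) => r x y; apply/ffunP=> j.
by rewrite !ffunE cell_coordP rmorphD rmorphM.
Qed.

Definition cell_coordK := projT1 (cid cell_coordK_subproof).

Lemma cell_coordK_map a x : cell_coordK (phi a) x = rho (cell_coord a x).
Proof. by rewrite /cell_coordK; case: cid => g /= ->; rewrite ffunE. Qed.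

Lemma cell_coordKE b : b = \sum_x cell_coordK b x *: phi (cell_vec x).
Proof.
move: b; apply: (base_change_ext bc) => [c x y //|c x y|a].
  rewrite scaler_sumr -big_split; apply: eq_bigr => j _ /=.
  by rewrite linearP !ffunE scalerA -scalerDl.
rewrite {1}(cell_coordE a) rmorph_sum; apply: eq_bigr => x _ /=.
by rewrite cell_coordK_map (base_changeZ bc).
Qed.

Lemma cell_coordK_vec x y : cell_coordK (phi (cell_vec x)) y = (y == x)%:R.
Proof. by rewrite cell_coordK_map cell_coord_vec rmorph_nat. Qed.

Lemma cell_vecMK b l i j x : ~~ (l < tag x)%O ->
  cell_coordK (b * phi (cell_vec (cell_ix i j))) x =
  \sum_(m < dim l) cell_repK l b m i * (x == cell_ix m j)%:R.
Proof.
move=> lx; move: b; apply: (@base_change_ext _ _ _ _ _ _ bc K^o) => [c y z|c y z|a].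
- by rewrite mulrDl -scalerAl linearP !ffunE.
- rewrite scaler_sumr -big_split; apply: eq_bigr => m _ /=.
  by rewrite linearP !mxE mulrDl -mulrA.
rewrite -rmorphM cell_coordK_map cell_vecM // rmorph_sum; apply: eq_bigr => m _.
by rewrite cell_repK_map !mxE rmorphM rmorph_nat.
Qed.

(* An element killed by all the cell representations maps the span of the cells >= l into the
   span of the cells > l. *)
Lemma cell_repK_nilpotent z : (forall l, cell_repK l z = 0) -> z * z = z -> z = 0.
Proof.
move=> z0 zz; rewrite [z]cell_coordKE big1 // => x _.
suff -> : cell_coordK z x = 0 by rewrite scale0r.
(* Induction on the number of cells strictly below that of [x]: in [z = z z], a term [z c_y] could
   reach [x] only when the cell of [y] is strictly smaller, and there the coordinate of [z] is
   already 0. *)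
have [n] := ubnP #|[set y | (y < tag x)%O]|; elim: n x => // n IH x.
rewrite ltnS => xn; rewrite -zz {2}[z]cell_coordKE mulr_sumr linear_sum sum_ffunE big1 // => y _.
rewrite -scalerAr linearZ ffunE /=.
have [yx|yx] := boolP (tag y < tag x)%O.
  rewrite IH ?scale0r //; apply: leq_trans xn; apply: proper_card.
  apply/properP; split; last by exists (tag y); rewrite !inE ?ltxx.
  by apply/subsetP=> u; rewrite !inE => /lt_trans; apply.
case: y yx => l [i j] /= yx; rewrite cell_vecMK // big1 ?scaler0 // => m _.
by rewrite z0 mxE mul0r.
Qed.

Hypothesis ssB : split_semisimple B.

(** In a product of matrix algebras a nonzero [b] has a multiple [y b] that is a nonzero idempotent;
    if [b] is killed by all cell representations, so is [y b], against [cell_repK_nilpotent]. *)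
Lemma cell_repK_inj b : (forall l, cell_repK l b = 0) -> b = 0.
Proof.
case: ssB => I [n [g gB]] b0; apply: contrapT => /eqP nb.
have [i [k [l bkl]]] : exists i k l, g i b k l != 0.
  apply: contrapT => h; case/eqP: nb.
  have [x [_ xu]] := gB (fun i => 0).
  rewrite -(xu 0) => [|i]; last by rewrite linear0.
  apply: esym; apply: xu => i; apply/matrixP=> k l; rewrite mxE; apply/eqP/negPn/negP => h'.
  by apply: h; exists i, k, l.
(* In block [i], [y] is the matrix unit at [(l, k)] divided by the entry of [b] at [(k, l)], which
   gives [y b] a single nonzero row, with entry 1 on the diagonal. *)
have [y [yP _]] := gB (fun j => \matrix_(k', l')
  (((j == i) && (k' == l :> nat) && (l' == k :> nat))%:R / g i b k l)).
have gz0 j : j != i -> g j (y * b) = 0.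
  move=> /negPf ji; rewrite rmorphM /= yP (_ : \matrix_(_, _) _ = 0) ?mul0r //.
  by apply/matrixP=> ? ?; rewrite !mxE ji mul0r.
have gz u v : g i (y * b) u v = (u == l)%:R * (g i b k v / g i b k l).
  rewrite rmorphM /= yP mxE (bigD1 k) //= big1 => [|m /negPf mk].
    by rewrite mxE !eqxx andbT addr0 -mulrA [_^-1 * _]mulrC.
  by rewrite mxE -!val_eqE /= in mk *; rewrite mk andbF !mul0r.
have z0 : y * b = 0.
  apply: cell_repK_nilpotent => [j|]; first by rewrite cell_repKM b0 mulmx0.
  have [x [_ xu]] := gB (fun j => g j (y * b)).
  rewrite -[RHS](xu _ (fun=> erefl)) -[LHS]xu // => j; rewrite rmorphM /=.
  have [->|/gz0 ->] := eqVneq j i; last by rewrite mulr0.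
  apply/matrixP=> u v; rewrite mxE (bigD1 l) //= big1 ?addr0 => [|m /negPf ml].
    by rewrite !gz eqxx mul1r divff // mulr1.
  by rewrite [X in _ * X]gz ml mul0r mulr0.
have := gz l l; rewrite z0 linear0 mxE eqxx divff // mulr1 => /esym/eqP.
by rewrite oner_eq0.
Qed.

(** The cell basis and the entries of all the cell representations have the same index set, so the
    matrix [W] of the joint representation is square, and injectivity makes it invertible. *)
Lemma cell_repK_surj (M : forall l, 'M[K]_(dim l)) :
  exists b, forall l, cell_repK l b = M l.
Proof.
pose N := #|{: Ix}|.
pose W : 'M[K]_N := \matrix_(x, y) cell_repK (tag (enum_val y))
  (phi (cell_vec (enum_val x))) (tagged (enum_val y)).1 (tagged (enum_val y)).2.
pose v (u : 'rV[K]_N) := \sum_x u 0 (enum_rank x) *: phi (cell_vec x).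
have vW u l i j : cell_repK l (v u) i j = (u *m W) 0 (enum_rank (cell_ix i j)).
  rewrite linear_sum summxE mxE (reindex enum_rank) /=; last first.
    by exists enum_val => x _; rewrite ?enum_rankK ?enum_valK.
  by apply: eq_bigr => x _; rewrite linearZ !mxE !enum_rankK.
have : row_free W.
  rewrite -kermx_eq0; apply/eqP/row_matrixP=> i.
  have : row i (kermx W) *m W = 0 by rewrite -row_mul mulmx_ker row0.
  move: (row i _) => u uW; rewrite row0.
  have vu0 : v u = 0.
    by apply: cell_repK_inj => l; apply/matrixP=> m n; rewrite vW uW !mxE.
  apply/rowP=> x; rewrite mxE -[x]enum_valK.
  have := congr1 (fun b => cell_coordK b (enum_val x)) vu0.
  rewrite linear0 ffunE linear_sum sum_ffunE (bigD1 (enum_val x)) //= big1 => [|y /negPf yx].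
    by rewrite linearZ ffunE cell_coordK_vec eqxx addr0 => h; rewrite -[LHS]mulr1; exact: h.
  by rewrite linearZ ffunE cell_coordK_vec eq_sym yx scaler0.
rewrite row_free_unit => Wu.
exists (v ((\row_x M (tag (enum_val x)) (tagged (enum_val x)).1 (tagged (enum_val x)).2)
  *m invmx W)).
move=> l; apply/matrixP=> i j.
by rewrite vW mulmxKV // mxE enum_rankK.
Qed.

End CellRepresentation.

Lemma bounded_finite (T : eqType) (n : nat) :
  (forall s : seq T, uniq s -> (size s <= n)%N) -> exists s, uniq s /\ forall x : T, x \in s.
Proof.
move=> bound; apply: contrapT => h.
have [s us sn] : exists2 s : seq T, uniq s & size s = n.+1.
  elim: n.+1 => [|m [s us sm]]; first by exists [::].
  have [x xs] : exists x, x \notin s.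
    apply: contrapT => h'; apply: h; exists s; split=> // x.
    by apply/negPn/negP => xs; apply: h'; exists x.
  by exists (x :: s); rewrite /= ?xs ?sm.
by have := bound s us; rewrite sn ltnn.
Qed.

(** * Finiteness of the cell bases *)

Section BasisBound.
Variables (R : idomainType) (K : fieldType) (rho : {rmorphism R -> K}).
Variables (A : algType R) (B : algType K) (phi : {rmorphism A -> B}).
Hypothesis bc : is_base_change rho phi.
Variables (I : choiceType) (b : I -> A).
Hypotheses (bB : is_basis b) (ssB : split_semisimple B).

Lemma lincombP (c : R) (u v : {fsfun I -> R with 0}) : exists w : {fsfun I -> R with 0},
  lincomb b w = c *: lincomb b u + lincomb b v /\ forall i, w i = c * u i + v i.
Proof.
pose S := (finsupp u `|` finsupp v)%fset.
have sup (w : {fsfun I -> R with 0}) : (finsupp w `<=` S)%fset ->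
    lincomb b w = \sum_(i <- S) w i *: b i.
  move=> wS; rewrite /lincomb (big_fset_incl _ wS) // => i _ /fsfun_dflt ->.
  by rewrite scale0r.
pose w : {fsfun I -> R with 0} := [fsfun i in S => c * u i + v i].
have wE i : w i = c * u i + v i.
  rewrite fsfunE; case: ifPn => //; rewrite inE negb_or => /andP[/fsfun_dflt -> /fsfun_dflt ->].
  by rewrite mulr0 addr0.
exists w; split=> //; rewrite !sup ?fsubsetUl ?fsubsetUr //; last first.
  by apply/fsubsetP => i; rewrite mem_finsupp fsfunE; case: ifP; rewrite ?eqxx.
rewrite scaler_sumr -big_split /=; apply: eq_bigr => i _.
by rewrite wE scalerDl scalerA.
Qed.

Lemma lincomb_delta i : exists u : {fsfun I -> R with 0},
  lincomb b u = b i /\ forall j, u j = (j == i)%:R.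
Proof.
pose u : {fsfun I -> R with 0} := [fsfun x in [fset i]%fset => 1].
have uE j : u j = (j == i)%:R by rewrite fsfunE !inE; case: (j == i).
exists u; split=> //; rewrite /lincomb (_ : finsupp u = [fset i]%fset).
  by rewrite big_seq_fset1 uE eqxx scale1r.
by apply/fsetP=> x; rewrite mem_finsupp uE !inE; case: (x == i); rewrite ?oner_eq0 ?eqxx.
Qed.

Lemma basis_functional i : exists g : {linear B -> K^o}, forall j, g (phi (b j)) = (j == i)%:R.
Proof.
have [co coP] := choice bB.
have coL c x y : co (c *: x + y) i = c * co x i + co y i.
  have [w [wP wi]] := lincombP c (co x) (co y).
  rewrite -wi; case: (coP (c *: x + y)) => _ /(_ w) -> //.
  by rewrite wP; case: (coP x) (coP y) => -> _ [-> _].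
have [r x y|g gP] := base_change_fun bc (V := K^o) (f := fun x => rho (co x i)).
  by rewrite coL rmorphD rmorphM.
exists g => j; rewrite gP.
have [w [wb wE]] := lincomb_delta j.
case: (coP (b j)) => _ /(_ w wb) ->.
by rewrite wE eq_sym rmorph_nat.
Qed.

(** Basis elements stay independent in [B], since the coordinate functionals specialize as well.
    Their number is then at most that of the matrix entries, by comparing ranks in [X Y = 1]. *)
Lemma basis_size_bound : exists n, forall s : seq I, uniq s -> (size s <= n)%N.
Proof.
case: ssB => J [n [g gB]].
pose Ix := {j : J & ('I_(n j).+1 * 'I_(n j).+1)%type}.
have [h hP] := choice basis_functional.
have unitP (x : Ix) : exists y, forall j k l,
    g j y k l = (existT _ j (k, l) == x)%:R.
  have [y [yP _]] := gB (fun j => \matrix_(k, l) (existT _ j (k, l) == x)%:R).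
  by exists y => j k l; rewrite yP mxE.
have [E EP] := choice unitP.
have decomp y : y = \sum_(x : Ix) g (tag x) y (tagged x).1 (tagged x).2 *: E x.
  have [z [_ zu]] := gB (fun j => g j y).
  rewrite -[LHS]zu // -[RHS]zu // => j; apply/matrixP=> k l.
  rewrite linear_sum summxE (bigD1 (existT _ j (k, l))) //= big1 ?addr0 => [|x /negPf xj].
    by rewrite linearZ mxE EP eqxx mulr1.
  by rewrite linearZ mxE EP eq_sym xj mulr0.
exists #|{: Ix}| => s us.
pose X : 'M[K]_(size s, #|{: Ix}|) := \matrix_(a, x)
  g (tag (enum_val x)) (phi (b (tnth (in_tuple s) a)))
    (tagged (enum_val x)).1 (tagged (enum_val x)).2.
pose Y : 'M[K]_(#|{: Ix}|, size s) := \matrix_(x, a) (h (tnth (in_tuple s) a) (E (enum_val x)) : K).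
have tinj : injective (tnth (in_tuple s)) by apply/tuple_uniqP.
have XY : X *m Y = 1%:M.
  apply/matrixP=> a a'; rewrite !mxE.
  have -> : (a == a')%:R = h (tnth (in_tuple s) a') (phi (b (tnth (in_tuple s) a))).
    by rewrite hP (inj_eq tinj).
  rewrite [X in h _ X]decomp linear_sum.
  rewrite (reindex (fun c : 'I_#|{: Ix}| => enum_val c)) /=; last first.
    by exists enum_rank => x _; rewrite ?enum_rankK ?enum_valK.
  by apply: eq_bigr => x _; rewrite linearZ !mxE.
by rewrite -(mxrank1 K (size s)) -XY (leq_trans (mxrankM_maxl _ _)) // rank_leq_col.
Qed.

End BasisBound.

Section CellFinite.
Variables (R : idomainType) (K : fieldType) (rho : {rmorphism R -> K}).
Variables (A : algType R) (B : algType K) (phi : {rmorphism A -> B}).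
Hypotheses (bc : is_base_change rho phi) (ssB : split_semisimple B).
Variables (inv : A -> A) (d : Order.disp_t) (L : porderType d) (D : cell_datum inv L).

(** A cell datum does not state that [T(l)] is finite. It is, because [t |-> (t, t)] embeds it into
    a basis of bounded size. *)
Lemma cell_enumeration : exists (dim : L -> nat) (en : forall l, 'I_(dim l) -> cell_T D l)
    (de : forall l, cell_T D l -> 'I_(dim l)),
  (forall l, cancel (en l) (de l)) /\ (forall l, cancel (de l) (en l)).
Proof.
have [n nP] := basis_size_bound bc (cell_basis D) ssB.
have fin l : exists s : seq (cell_T D l), uniq s /\ forall x, x \in s.
  apply: (@bounded_finite _ n) => s us.
  pose T l : Type := (cell_T D l * cell_T D l)%type.
  have inj (x y : T l) : existT T l x = existT T l y -> x = y by exact: eq_from_Tagged.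
  rewrite -(size_map (fun t => existT T l (t, t))).
  by apply: nP; rewrite map_inj_uniq // => t t' /inj [].
pose s l := projT1 (cid (fin l)).
have sP l : uniq (s l) /\ forall x, x \in s l by rewrite /s; case: cid.
have ix_lt l x : (index x (s l) < size (s l))%N by rewrite index_mem; case: (sP l).
exists (fun l => size (s l)), (fun l => tnth (in_tuple (s l))), (fun l x => Ordinal (ix_lt l x)).
split=> l x.
  apply: val_inj; rewrite /= (tnth_nth (tnth (in_tuple (s l)) x)).
  by apply: index_uniq; case: (sP l).
by rewrite (tnth_nth x) /= nth_index //; case: (sP l).
Qed.

End CellFinite.

(** * Restriction of cell modules *)

(** [N] is the module of column vectors with action through [r]. For [r 1 = 1], the case [a = 1] of
    the equation is additivity. *)
Definition presented (R : nzRingType) (B : nzRingType) n (r : B -> 'M[R]_n)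
    (N : lmodType B) : Prop :=
  exists beta : 'cV[R]_n -> N,
    bijective beta /\ forall a x y, beta (r a *m x + y) = a *: beta x + beta y.

(* The matrix form of a filtration of the column module of r: P is a projection onto the current
   submodule, Bm and U are a lift of the basis of the top quotient and its coordinates. *)
Fixpoint matrix_chain (R : nzRingType) (B L : Type) (dim : L -> nat)
    (rep : forall l, B -> 'M[R]_(dim l)) n (r : B -> 'M[R]_n) (P : 'M[R]_n) (ls : seq L) : Prop :=
  (forall a, P *m r a *m P = r a *m P) /\
  if ls is l :: ls' then
    exists (Bm : 'M[R]_(n, dim l)) (U : 'M[R]_(dim l, n)),
      [/\ U *m Bm = 1%:M, P *m Bm = Bm, U *m P = U,
          forall a, U *m r a *m P = rep l a *m U
        & matrix_chain rep r (P - Bm *m U) ls']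
  else P = 0.

Lemma linear_col_mx (R : comNzRingType) m n (f : 'cV[R]_m -> 'cV[R]_n) :
  linear f -> exists U : 'M[R]_(n, m), forall x, U *m x = f x.
Proof.
move=> fL.
pose g (x : 'rV[R]_m) := (f x^T)^T.
have gL : linear g by move=> a x y; rewrite /g !linearP /= fL linearP.
pose G : {linear 'rV[R]_m -> 'rV[R]_n} := HB.pack g (GRing.isLinear.Build _ _ _ _ g gL).
exists (lin1_mx G)^T => x.
by rewrite -[LHS]trmxK trmx_mul trmxK mul_rV_lin1 /= /g !trmxK.
Qed.

Lemma add_self0 (V : zmodType) (x : V) : x = x + x -> x = 0.
Proof. by move=> h; apply: (addrI x); rewrite addr0. Qed.

Lemma eq_col_mx (R : nzRingType) m n (X Y : 'M[R]_(m, n)) :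
  (forall x : 'cV[R]_n, X *m x = Y *m x) -> X = Y.
Proof.
move=> h; apply/matrixP=> i j.
by have := congr1 (fun v : 'cV[R]_m => v i 0) (h (delta_mx j 0)); rewrite -!colE !mxE.
Qed.

Section Filtration.
Variables (R : idomainType) (B : algType R) (L : Type) (dim : L -> nat).
Variables (rep : forall l, B -> 'M[R]_(dim l)) (n : nat) (r : B -> 'M[R]_n).
Hypothesis rep_scalar : forall l c, rep l (c%:A) = c%:M.
Hypothesis r_scalar : forall c, r (c%:A) = c%:M.
Variables (M : lmodType B) (beta : 'cV[R]_n -> M).
Hypothesis beta_bij : bijective beta.
Hypothesis betaP : forall a x y, beta (r a *m x + y) = a *: beta x + beta y.

(** The quotients are free over [R], so each step of the filtration splits: [Bm] lifts a basis of
    the quotient, [U] reads off coordinates there, and [P - Bm U] projects onto the next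
    submodule. *)
Lemma filtered_matrix_chain (F : M -> Prop) (P : 'M[R]_n) ls :
    submodule F -> (forall x, F (beta x) <-> P *m x = x) -> P *m P = P ->
  filtered (fun l N => presented (rep l) N) F ls -> matrix_chain rep r P ls.
Proof.
have [beta' betaK beta'K] := beta_bij.
have beta0 : beta 0 = 0.
  by apply: add_self0; have := betaP 1 0 0; rewrite mulmx0 addr0 scale1r.
have betaM a x : beta (r a *m x) = a *: beta x by rewrite -[_ *m x]addr0 betaP beta0 addr0.
elim: ls F P => [|l ls IH] F P [F0 FD] FP PP.
  move=> /= h; have -> : P = 0.
    apply: eq_col_mx => x; rewrite mul0mx; apply: (can_inj betaK).
    by rewrite beta0; apply: h; apply/FP; rewrite mulmxA PP.
  by split=> // a; rewrite !mulmx0.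
move=> [F' [[F'0 F'D] F'F [N [gam [[gam' gamK gam'K] gamP]] [g [gD gsur gker]]] fls]].
have FPx x : F (beta (P *m x)) by apply/FP; rewrite mulmxA PP.
have stab a : P *m r a *m P = r a *m P.
  apply: eq_col_mx => x; rewrite -!mulmxA; apply/FP.
  by rewrite betaM -[_ *: _]addr0; apply: FD.
have g0 : g 0 = 0.
  by apply: add_self0; have := gD 1 0 0 F0 F0; rewrite !scale1r !addr0.
have gam0 : gam 0 = 0.
  by apply: add_self0; have := gamP 1 0 0; rewrite mulmx0 addr0 scale1r.
have U0L : linear (fun x => gam' (g (beta (P *m x)))).
  move=> c x y /=; apply: (can_inj gamK).
  rewrite gam'K -[X in _ = gam (X + _)]mul_scalar_mx -(rep_scalar l) gamP !gam'K mulmxDr.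
  by rewrite -scalemxAr -mul_scalar_mx -r_scalar betaP gD.
have [U UP] := linear_col_mx U0L.
have gU x : gam (U *m x) = g (beta (P *m x)) by rewrite UP gam'K.
have gsur' s : exists x, F x /\ g x = gam (delta_mx s 0).
  by have [x Fx gx] := gsur (gam (delta_mx s 0)); exists x.
have [m mP] := choice gsur'.
pose Bm : 'M[R]_(n, dim l) := \matrix_(i, s) beta' (m s) i 0.
have BmP s : Bm *m delta_mx s 0 = beta' (m s).
  by apply/colP=> i; rewrite -colE !mxE.
have PBm : P *m Bm = Bm.
  apply/matrixP=> i s; move: (congr1 (fun v : 'cV[R]_n => v i 0) (BmP s)).
  have [+ _] := mP s; rewrite -[m s]beta'K => /FP.
  rewrite -BmP mulmxA => /(congr1 (fun v : 'cV[R]_n => v i 0)).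
  by rewrite -!colE !mxE.
have UBm : U *m Bm = 1%:M.
  apply/matrixP=> i s.
  have : U *m (Bm *m delta_mx s 0) = delta_mx s 0 :> 'cV_(dim l).
    apply: (can_inj gamK); rewrite gU mulmxA PBm BmP beta'K.
    by case: (mP s).
  by rewrite mulmxA => /(congr1 (fun v : 'cV[R]_(dim l) => v i 0)); rewrite -colE !mxE eqxx andbT.
have UPU : U *m P = U.
  by apply: eq_col_mx => x; apply: (can_inj gamK); rewrite -mulmxA !gU mulmxA PP.
split=> //; exists Bm, U; split=> // [a|].
  apply: eq_col_mx => x; apply: (can_inj gamK); rewrite -!mulmxA gU.
  rewrite !mulmxA stab -mulmxA betaM -[_ *: _]addr0 gD // g0 addr0.
  by rewrite -mulmxA -[_ *m (_ *m x)]addr0 gamP gam0 addr0 gU.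
apply: (IH F') => // [x|].
  split=> [F'x|P'x].
    have Px : P *m x = x by apply/FP/F'F.
    have Ux : U *m x = 0.
      by apply: (can_inj gamK); rewrite gU Px gam0; apply/gker => //; apply: F'F.
    by rewrite mulmxBl -mulmxA Ux mulmx0 subr0.
  have Px : P *m x = x by rewrite -P'x mulmxA mulmxBr mulmxA PP PBm.
  apply/gker; first exact/FP.
  have Ux : U *m x = 0 by rewrite -P'x mulmxA mulmxBr mulmxA UBm mul1mx UPU subrr mul0mx.
  by rewrite -Px -gU Ux.
rewrite mulmxBl !mulmxBr PP mulmxA PBm -(mulmxA Bm) UPU -(mulmxA Bm U) (mulmxA U Bm) UBm mul1mx.
by rewrite subrr subr0.
Qed.

End Filtration.

Section ChainConsequences.
Variables (B L : Type).

(** By cyclicity, the part [Bm U] split off from [P] contributes the trace of [U r(a) Bm], which is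
    that of the diagonal block. *)
Lemma matrix_chain_trace (R : comNzRingType) (dim : L -> nat) (rep : forall l, B -> 'M[R]_(dim l))
    n (r : B -> 'M[R]_n) P ls a :
  matrix_chain rep r P ls -> \tr (r a *m P) = \sum_(l <- ls) \tr (rep l a).
Proof.
elim: ls P => [|l ls IH] P /= [_].
  by move=> ->; rewrite mulmx0 mxtrace0 big_nil.
case=> Bm [U [UB PB UP Ur ch]]; rewrite big_cons -(IH _ ch).
rewrite -[in LHS](subrK (Bm *m U) P) mulmxDr mxtraceD addrC; congr (_ + _).
rewrite mulmxA mxtrace_mulC mulmxA -{1}PB mulmxA Ur.
by rewrite -mulmxA UB mulmx1.
Qed.

(** The rank of a block triangular matrix may exceed the sum of the ranks of its diagonal blocks, as
    for a nilpotent matrix; idempotency of [r a] excludes this. *)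
Lemma matrix_chain_rank (K : fieldType) (dim : L -> nat) (rep : forall l, B -> 'M[K]_(dim l))
    n (r : B -> 'M[K]_n) P ls a :
    matrix_chain rep r P ls -> r a *m r a = r a ->
  (\rank (r a *m P) <= \sum_(l <- ls) \rank (rep l a))%N.
Proof.
move=> + EE; elim: ls P => [|l ls IH] P /= [stab].
  by move=> ->; rewrite mulmx0 mxrank0 big_nil.
case=> Bm [U [UB PB UP Ur /IH {IH}]]; rewrite big_cons.
move: (stab a) (Ur a) EE; move: (r a) (rep l a) (\sum_(_ <- _) _)%N => E e s PEP UEP EE leEP'.
set P' := P - Bm *m U in leEP'.
have UEB : U *m E *m Bm = e by rewrite -PB mulmxA UEP -mulmxA UB mulmx1.
(* Idempotency writes the columns of [E Bm] through [E Bm e] and [E P'], so that [E P] becomes a sum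
   of two products, one with factor [E P'] and one with factor [e]. *)
have EB : E *m Bm = E *m Bm *m e + E *m P' *m (E *m Bm).
  have -> : E *m Bm *m e = E *m (Bm *m U) *m (E *m Bm) by rewrite -UEB !mulmxA.
  rewrite -mulmxDl -mulmxDr addrC subrK.
  by rewrite mulmxA -{2}PB (mulmxA _ P) -(mulmxA E P) -(mulmxA E) PEP !mulmxA EE -mulmxA PB.
have -> : E *m P = E *m P' *m (1%:M + E *m Bm *m U) + E *m Bm *m e *m U.
  rewrite mulmxDr mulmx1 -addrA -[in E *m P](subrK (Bm *m U) P) -/P' mulmxDr; congr (_ + _).
  by rewrite [LHS]mulmxA [in LHS]EB mulmxDl addrC !mulmxA.
apply: leq_trans (mxrank_add _ _) _; rewrite addnC; apply: leq_add.
  by rewrite (leq_trans (mxrankM_maxl _ _)) // mxrankM_maxr.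
by rewrite (leq_trans (mxrankM_maxl _ _)).
Qed.

End ChainConsequences.

Section ChainBaseChange.
Variables (R : idomainType) (K : fieldType) (rho : {rmorphism R -> K}).
Variables (A : algType R) (B : algType K) (phi : {rmorphism A -> B}).
Hypothesis bc : is_base_change rho phi.
Variables (L : Type) (dim : L -> nat) (rep : forall l, A -> 'M[R]_(dim l)).
Variable repK : forall l, {linear B -> 'M[K]_(dim l)}.
Hypothesis repK_map : forall l a, repK l (phi a) = map_mx rho (rep l a).
Variables (n : nat) (r : A -> 'M[R]_n) (rK : {linear B -> 'M[K]_n}).
Hypothesis rK_map : forall a, rK (phi a) = map_mx rho (r a).

(** A chain consists of matrix identities linear in [a], so it specializes to [K]; this is the
    purpose of the matrix form of a filtration. *)
Lemma matrix_chain_base_change P ls :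
  matrix_chain rep r P ls -> matrix_chain repK rK (map_mx rho P) ls.
Proof.
have ext m p (X Y : B -> 'M[K]_(m, p)) : linear X -> linear Y ->
  (forall a, X (phi a) = Y (phi a)) -> X =1 Y by move=> XL YL h; apply: (base_change_ext bc XL YL).
elim: ls P => [|l ls IH] P /= [stab h]; split.
- apply: ext => [c x y|c x y|a].
  + by rewrite linearP mulmxDr mulmxDl -scalemxAr -scalemxAl.
  + by rewrite linearP mulmxDl -scalemxAl.
  + by rewrite rK_map -!map_mxM stab.
- by rewrite h map_mx0.
- apply: ext => [c x y|c x y|a].
  + by rewrite linearP mulmxDr mulmxDl -scalemxAr -scalemxAl.
  + by rewrite linearP mulmxDl -scalemxAl.
  + by rewrite rK_map -!map_mxM stab.
case: h => Bm [U [UB PB UP Ur ch]]; exists (map_mx rho Bm), (map_mx rho U); split.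
- by rewrite -map_mxM UB map_mx1.
- by rewrite -map_mxM PB.
- by rewrite -map_mxM UP.
- apply: ext => [c x y|c x y|a].
  + by rewrite linearP mulmxDr mulmxDl -scalemxAr -scalemxAl.
  + by rewrite linearP mulmxDl -scalemxAl.
  + by rewrite rK_map repK_map -!map_mxM Ur.
- by rewrite -map_mxM -map_mxB; apply: IH.
Qed.

End ChainBaseChange.

(** * Column modules and families of matrix representations *)

Section ColumnModule.
Variables (R : comNzRingType) (B : algType R) (n : nat) (r : B -> 'M[R]_n).
Hypotheses (rL : linear r) (r1 : r 1 = 1%:M) (rM : forall a b, r (a * b) = r a *m r b).

(** A separate name for the column vectors, tagged by [r], to carry the action of [B] apart from the
    usual scalar action. *)
Definition col_module of (B -> 'M[R]_n) : Type := 'cV[R]_n.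
HB.instance Definition _ := GRing.Zmodule.on (col_module r).

Lemma col_module_presented : exists M : lmodType B, presented r M.
Proof.
pose sc (a : B) (x : col_module r) : col_module r := r a *m (x : 'cV[R]_n).
have scA a b x : sc a (sc b x) = sc (a * b) x by rewrite /sc rM mulmxA.
have sc1 : left_id 1 sc by move=> x; rewrite /sc r1 mul1mx.
have scDr : right_distributive sc +%R by move=> a x y; apply: mulmxDr.
have scDl x : {morph sc^~ x : a b / a + b}.
  by move=> a b; rewrite /sc -[a in LHS]scale1r rL scale1r mulmxDl.
pose M : lmodType B := HB.pack (col_module r)
  (GRing.Zmodule_isLmodule.Build B (col_module r) scA sc1 scDr scDl).
by exists M, (fun x => x); split=> //; exists (fun x => x).
Qed.

End ColumnModule.

(** The representations identify [B] with a product of matrix algebras. Size 0 is allowed here, as a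
    cell may have an empty index set. *)
Definition matrix_family (K : fieldType) (B : algType K) (L : finType) (dim : L -> nat)
    (rep : forall l, {linear B -> 'M[K]_(dim l)}) : Prop :=
  [/\ forall l, rep l 1 = 1%:M, forall l a b, rep l (a * b) = rep l a *m rep l b,
      forall a, (forall l, rep l a = 0) -> a = 0
    & forall X : (forall l, 'M[K]_(dim l)), exists a, forall l, rep l a = X l].

Lemma presented_isomorphic (R B : nzRingType) n (r : B -> 'M[R]_n) (M N : lmodType B) :
  presented r M -> presented r N -> isomorphic M N.
Proof.
move=> [bM [[cM bMK cMK] bMP]] [bN [[cN bNK cNK] bNP]].
have gL : linear (bN \o cM).
  by move=> a x y /=; rewrite -{1}[x]cMK -{1}[y]cMK -bMP bMK bNP.
pose g : {linear M -> N} := HB.pack (bN \o cM) (GRing.isLinear.Build _ _ _ _ (bN \o cM) gL).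
by exists g; exists (bM \o cN) => x /=; rewrite ?bNK ?cMK ?bMK ?cNK.
Qed.

Lemma isomorphic_presented (R B : nzRingType) n (r : B -> 'M[R]_n) (M N : lmodType B) :
  isomorphic M N -> presented r N -> presented r M.
Proof.
move=> [g [h gK hK]] [b [b_bij bP]]; exists (h \o b); split.
  by apply: bij_comp => //; exists g.
by move=> a x y /=; rewrite bP; apply: (can_inj gK); rewrite hK linearP !hK.
Qed.

Section MatrixFamily.
Variables (K : fieldType) (B : algType K) (L : finType) (dim : L -> nat).
Variable rep : forall l, {linear B -> 'M[K]_(dim l)}.
Hypothesis fam : matrix_family rep.

Let rep1 l : rep l 1 = 1%:M. Proof. by case: fam. Qed.
Let repM l a b : rep l (a * b) = rep l a *m rep l b. Proof. by case: fam. Qed.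
Let rep_surj (X : forall l, 'M[K]_(dim l)) : exists a, forall l, rep l a = X l.
Proof. by case: fam. Qed.
Let rep_eq a b : (forall l, rep l a = rep l b) -> a = b.
Proof.
case: fam => _ _ inj _ ab; apply/eqP; rewrite -subr_eq0; apply/eqP/inj => l.
by rewrite linearB ab subrr.
Qed.

Let at_block (l0 : L) (X : 'M[K]_(dim l0)) l : 'M[K]_(dim l) :=
  match eqVneq l0 l with
  | EqNotNeq e => castmx (congr1 dim e, congr1 dim e) X
  | _ => 0
  end.

Let at_block_same l X : at_block X l = X :> 'M[K]_(dim l).
Proof.
rewrite /at_block; case: eqVneq => [e|]; last by rewrite eqxx.
by rewrite (eq_irrelevance e erefl) castmx_id.
Qed.

Let at_block_neq l0 l (X : 'M[K]_(dim l0)) : l0 != l -> at_block X l = 0.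
Proof. by rewrite /at_block; case: eqVneq => // ->; rewrite eqxx. Qed.

Lemma block_lift : exists lift : forall l, 'M[K]_(dim l) -> B,
  (forall l X, rep l (lift l X) = X) /\ forall l m X, l != m -> rep m (lift l X) = 0.
Proof.
have [f fP] := choice (fun lX : {l : L & 'M[K]_(dim l)} => rep_surj (at_block (tagged lX))).
exists (fun l X => f (existT _ l X)); split=> [l X|l m X lm].
  by rewrite fP at_block_same.
by rewrite fP /= at_block_neq.
Qed.

(** Some diagonal matrix unit, at position [k] of a block [l], acts nontrivially on [x]; sending a
    vector [v] to the matrix with column [k] equal to [v], applied to [m], identifies the columns of
    block [l] with [M]. *)
Lemma simple_presented (M : lmodType B) : simple_module M ->
  exists2 l, (0 < dim l)%N & presented (rep l) M.
Proof.
case=> [[x /eqP x0] Ms]; have [lift [liftE lift0]] := block_lift.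
have one : 1 = \sum_l \sum_i lift l (delta_mx i i).
  apply: rep_eq => m; rewrite rep1 linear_sum (bigD1 m) //= [X in _ + X]big1 ?addr0 => [|l lm].
    rewrite linear_sum; under eq_bigr do rewrite liftE.
    apply/matrixP=> i j; rewrite summxE mxE (bigD1 i) //= big1 => [|k /negPf ki].
      by rewrite mxE eqxx addr0 eq_sym.
    by rewrite mxE eq_sym ki.
  by rewrite linear_sum big1 // => i _; rewrite lift0.
have [l [k mk]] : exists l k, lift l (delta_mx k k) *: x <> 0.
  apply: contrapT => h; apply: x0; rewrite -[x]scale1r one scaler_suml big1 // => l _.
  rewrite scaler_suml big1 // => k _; apply: contrapT => hk.
  by apply: h; exists l, k.
exists l; first by apply: leq_ltn_trans (ltn_ord k).
have [m mE] : exists m, m = lift l (delta_mx k k) *: x by exists (lift l (delta_mx k k) *: x).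
pose beta (v : 'cV[K]_(dim l)) := lift l (v *m delta_mx 0 k) *: m.
have betaP a u v : beta (rep l a *m u + v) = a *: beta u + beta v.
  rewrite /beta scalerA -scalerDl; congr (_ *: _); apply: rep_eq => j.
  rewrite linearD repM; have [<-|lj] := eqVneq l j; last by rewrite !lift0 // mulmx0 addr0.
  by rewrite !liftE mulmxDl mulmxA.
have beta0 : beta 0 = 0.
  by apply: add_self0; have := betaP 1 0 0; rewrite mulmx0 addr0 scale1r.
have beta_inj v : beta v = 0 -> v = 0.
  move=> bv; apply/colP=> j; rewrite mxE; apply: contrapT => /eqP vj; apply: mk.
  have -> : lift l (delta_mx k k) *: x = ((v j 0)^-1 *: lift l (delta_mx k j)) *: beta v.
    rewrite /beta mE !scalerA; congr (_ *: _); apply: rep_eq => i.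
    have [<-|li] := eqVneq l i; last by rewrite !repM !lift0 // !mulmx0.
    rewrite !repM linearZ /= !liftE.
    have dv : delta_mx k j *m v = v j 0 *: delta_mx k 0.
      apply/colP=> a; rewrite !mxE (bigD1 j) //= big1 ?addr0 => [|c /negPf cj].
        by rewrite !mxE !eqxx !andbT mulrC.
      by rewrite !mxE cj andbF mul0r.
    rewrite -(mulmxA v) mul_delta_mx mulmxA -scalemxAl dv scalerA mulVf // scale1r.
    by rewrite mul_delta_mx.
  by rewrite bv scaler0.
have [||im] := Ms (fun y => exists v, beta v = y).
- split; first by exists 0.
  move=> a _ _ [u <-] [v <-]; exists (rep l a *m u + v); exact: betaP.
- move=> im0; case: mk; apply: im0; exists (delta_mx k 0).
  rewrite /beta mE scalerA; congr (_ *: _); apply: rep_eq => i.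
  have [<-|li] := eqVneq l i; last by rewrite !repM !lift0 // mulmx0.
  by rewrite repM !liftE mul_delta_mx mul_delta_mx.
have [g gP] := choice im; exists beta; split=> //.
exists g => // v; apply/eqP; rewrite -subr_eq0; apply/eqP/beta_inj.
have := betaP (-1) v (g (beta v)); rewrite linearN rep1 mulNmx mul1mx addrC => ->.
by rewrite gP scaleN1r addNr.
Qed.

Variable z : forall l, 'I_(dim l).

(** One diagonal matrix unit is chosen in each block, at position [z l]; the factor [(l == m)]
    avoids casts between blocks. *)
Lemma matrix_family_idem : exists p : L -> B,
  (forall l m, rep m (p l) = (l == m)%:R *: delta_mx (z m) (z m)) /\ idem_system p.
Proof.
have ex l : exists a, forall m, rep m a = (l == m)%:R *: delta_mx (z m) (z m).
  exact: rep_surj.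
have [p pP] := choice ex; exists p; split=> //.
have mul_E m (X : 'M[K]_(dim m)) (y : 'I_(dim m)) :
    delta_mx y y *m X *m delta_mx y y = X y y *: delta_mx y y.
  apply/matrixP=> i j; rewrite !mxE (bigD1 y) //= big1 ?addr0 => [|k /negPf ky].
    rewrite !mxE (bigD1 y) //= big1 ?addr0 => [|k /negPf ky].
      by rewrite !mxE !eqxx /= andbT -mulnb natrM mulrA (mulrC (X y y)).
    by rewrite !mxE ky andbF mul0r.
  by rewrite !mxE ky mulr0.
have [lift [liftE lift0]] := block_lift.
split.
- move=> l; apply: contraTneq isT => pl0.
  have := pP l l; rewrite pl0 linear0 eqxx scale1r.
  move=> /(congr1 (fun X : 'M[K]_(dim l) => X (z l) (z l))); rewrite !mxE !eqxx => /eqP.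
  by rewrite eq_sym oner_eq0.
- move=> l; apply: rep_eq => m; rewrite repM !pP -scalemxAl -scalemxAr mul_delta_mx scalerA.
  by rewrite -natrM mulnb andbb.
- move=> l b; exists (rep l b (z l) (z l)); apply: rep_eq => m.
  rewrite !repM linearZ /= !pP -!scalemxAl -scalemxAr mul_E.
  have [<-|lm] := eqVneq l m; first by rewrite !scale1r.
  by rewrite !scale0r scaler0.
- move=> l l' b ll'; apply: rep_eq => m; rewrite !repM !pP linear0.
  have [<-|lm] := eqVneq l m; last by rewrite scale0r !mul0mx.
  by rewrite eq_sym (negPf ll') scale0r mulmx0.
exists [seq (l, (lift l (delta_mx i (z l)), lift l (delta_mx (z l) i))) |
  l <- enum L, i <- enum 'I_(dim l)].
rewrite big_allpairs_dep /= big_enum /=.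
under eq_bigr do rewrite big_enum /=.
apply: rep_eq => m; rewrite rep1 linear_sum (bigD1 m) //= [X in _ + X]big1 ?addr0 => [|l lm].
  rewrite linear_sum; under eq_bigr => i _.
    rewrite !repM !liftE pP eqxx scale1r !mul_delta_mx.
    over.
  apply/matrixP=> i j; rewrite summxE mxE (bigD1 i) //= big1 => [|k /negPf ki].
    by rewrite mxE eqxx addr0 eq_sym.
  by rewrite mxE eq_sym ki.
by rewrite linear_sum big1 // => i _; rewrite !repM lift0 // !mul0mx.
Qed.

Lemma rank_le1_factor m n (X : 'M[K]_(m, n)) : (\rank X <= 1)%N ->
  exists (c : 'cV_m) (r : 'rV_n), X = c *m r.
Proof.
move=> X1; have [->|X0] := eqVneq X 0; first by exists 0, 0; rewrite mul0mx.
have [i Xi] : exists i, row i X != 0.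
  apply: contrapT => h; case/eqP: X0; apply/row_matrixP => i; rewrite row0.
  by apply: contrapT => /eqP Xi; apply: h; exists i.
have /submxP[c Xc] : (X <= row i X)%MS.
  by rewrite -(geq_leqif (mxrank_leqif_sup (row_sub i X))) (leq_trans X1) // lt0n mxrank_eq0.
by exists c, (row i X).
Qed.

(** [x B p] is the column space of block [w] of [x]. For [e = 1] the rank bound factors that block
    as [c r], and the trace gives [r c = 1], so it is an idempotent of rank exactly 1. *)
Lemma matrix_family_line (x p : B) (w : L) (e : bool) :
    (forall m, rep m p = (w == m)%:R *: delta_mx (z m) (z m)) ->
  (\rank (rep w x) <= e)%N -> \tr (rep w x) = e%:R -> line x p e.
Proof.
move=> pP; case: e => /= [rk tr1|]; last first.
  rewrite leqn0 mxrank_eq0 => /eqP xw _ b; apply: rep_eq => m.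
  rewrite !repM pP linear0; have [<-|_] := eqVneq w m; first by rewrite xw !mul0mx.
  by rewrite scale0r mulmx0.
have [c [r xE]] := rank_le1_factor rk.
have rc : r *m c = 1%:M.
  by rewrite [LHS]mx11_scalar -trace_mx11 -mxtrace_mulC -xE tr1.
have [lift [liftE lift0]] := block_lift.
have c0 : c != 0.
  apply: contraTneq isT => c0; move: tr1; rewrite xE c0 mul0mx mxtrace0 => /esym/eqP.
  by rewrite oner_eq0.
exists (lift w (c *m delta_mx 0 (z w))); split=> [||b].
- apply: contra_neq c0 => l0; have := liftE w (c *m delta_mx 0 (z w)); rewrite l0 linear0.
  move=> /esym/(congr1 (fun X : 'M[K]_(dim w) => X *m delta_mx (z w) (0 : 'I_1))).
  by rewrite mul0mx -mulmxA mul_delta_mx [delta_mx 0 0]mx11_scalar mxE !eqxx mulmx1.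
- apply: rep_eq => m; rewrite !repM pP; have [<-|wm] := eqVneq w m; last first.
    by rewrite scale0r mulmx0 lift0.
  by rewrite liftE scale1r xE -!mulmxA mul_delta_mx (mulmxA r) rc mul1mx.
exists ((r *m rep w b) 0 (z w)); apply: rep_eq => m.
rewrite !repM linearZ /= pP; have [<-|wm] := eqVneq w m; last first.
  by rewrite scale0r mulmx0 lift0 // scaler0.
rewrite liftE scale1r xE -!mulmxA (mulmxA r) scalemxAr; congr (_ *m _).
apply/rowP=> j; rewrite !mxE (bigD1 (z w)) //= big1 ?addr0 => [|i /negPf iz].
  by rewrite !mxE !eqxx.
by rewrite !mxE iz mulr0.
Qed.

End MatrixFamily.

Record cell_enum (R : idomainType) (A : algType R) (inv : A -> A) (d : Order.disp_t)
    (L : finPOrderType d) (D : cell_datum inv L) := CellEnum {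
  ce_dim : L -> nat;
  ce_en : forall l, 'I_(ce_dim l) -> cell_T D l;
  ce_de : forall l, cell_T D l -> 'I_(ce_dim l);
  ce_enK : forall l, cancel (ce_en (l := l)) (ce_de (l := l));
  ce_deK : forall l, cancel (ce_de (l := l)) (ce_en (l := l))
}.

Lemma filtered_mono (B : nzRingType) (M : lmodType B) (I : Type) (S S' : I -> lmodType B -> Prop)
    (F : M -> Prop) ls :
  (forall i N, S i N -> S' i N) -> filtered S F ls -> filtered S' F ls.
Proof.
move=> SS'; elim: ls F => [//|i ls IH] F [F' [F'sub F'F [N SN FF'] fl]].
by exists F'; split=> //; [exists N => //; apply: SS' | apply: IH].
Qed.

(** * Cell modules as modules of column vectors *)

Section CellModules.
Variables (R : idomainType) (A : algType R) (inv : A -> A) (d : Order.disp_t).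
Variables (L : finPOrderType d) (D : cell_datum inv L) (E : cell_enum D).
Local Notation en := (@ce_en _ _ _ _ _ _ E).
Local Notation de := (@ce_de _ _ _ _ _ _ E).
Local Notation enK := (fun l => @ce_enK _ _ _ _ _ _ E l).
Local Notation deK := (fun l => @ce_deK _ _ _ _ _ _ E l).
Local Notation rep l := (cell_rep en l).

Lemma cell_rep_scalar l c : cell_rep en l (c%:A) = c%:M.
Proof.
have h := cell_repP enK deK l.
have h0 : rep l 0 = 0 by apply: add_self0; have := h 1 0 0; rewrite !scale1r addr0.
by rewrite -[c%:A]addr0 h [cell_rep _ _ 0]h0 addr0 (cell_rep1 enK deK) scalemx1.
Qed.

Lemma cell_module_presented l (N : lmodType A) : is_cell_module D l N -> presented (rep l) N.
Proof.
case=> b [bB bP].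
have [co [coE co_sum]] := finite_basis (enK l) (deK l) bB.
pose beta (x : 'cV[R]_(ce_dim E l)) : res N (in_alg A) := \sum_j x j 0 *: b (en j).
exists beta; split.
  exists (fun m => \col_j co m j) => [x|m].
    by apply/colP=> j; rewrite mxE co_sum.
  by rewrite [RHS]coE; apply: eq_bigr => j _; rewrite mxE.
have betaP c x y : beta (c *: x + y) = c *: beta x + beta y.
  rewrite scaler_sumr -big_split; apply: eq_bigr => j _ /=.
  by rewrite !mxE scalerDl scalerA.
have resZ c (m : N) : (c *: (m : res N (in_alg A))) = (c%:A *: m : N) by [].
move=> a x y; rewrite -[rep l a *m x]scale1r betaP scale1r; congr (_ + _).
have -> : a *: (beta x : N) = \sum_j a *: (x j 0 *: b (en j) : N).
  exact: scaler_sumr.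
under [RHS]eq_bigr => j _.
  rewrite resZ scalerA mulr_algr -mulr_algl -scalerA bP (lincomb_finite _ (enK l) (deK l)) -resZ.
  rewrite scaler_sumr.
  over.
rewrite exchange_big; apply: eq_bigr => i _ /=.
by rewrite mxE scaler_suml; apply: eq_bigr => j _; rewrite scalerA mulrC mxE.
Qed.

Lemma presented_cell_module l (N : lmodType A) : presented (rep l) N -> is_cell_module D l N.
Proof.
case=> beta [[beta' betaK beta'K] betaP].
have beta0 : beta 0 = 0.
  by apply: add_self0; have := betaP 1 0 0; rewrite mulmx0 addr0 scale1r.
have betaD x y : beta (x + y) = beta x + beta y.
  by have := betaP 1 x y; rewrite (cell_rep1 enK deK) mul1mx scale1r.
have resZ c (m : N) : (c *: (m : res N (in_alg A))) = (c%:A *: m : N) by [].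
pose b (t : cell_T D l) : res N (in_alg A) := beta (delta_mx (de t) 0).
have bsum (u : 'I_(ce_dim E l) -> R) : \sum_j u j *: b (en j) = beta (\col_j u j) :> N.
  have -> : \col_j u j = \sum_j u j *: delta_mx j 0 :> 'cV[R]_(ce_dim E l).
    rewrite [LHS]matrix_sum_delta; apply: eq_bigr => j _.
    by rewrite big_ord1 mxE.
  rewrite (big_morph beta betaD beta0); apply: eq_bigr => j _.
  rewrite resZ -[RHS]addr0 -beta0 -mul_scalar_mx -cell_rep_scalar -[in RHS]betaD addr0.
  by rewrite -[_ *m _]addr0 betaP beta0 addr0 /b enK.
exists b; split.
  pose co (x : res N (in_alg A)) j := beta' (x : N) j 0.
  apply: (finite_is_basis (enK l) (deK l) (co := co)) => [x|u j]; rewrite /co.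
    by rewrite bsum -[LHS]beta'K; congr beta; apply/colP=> j; rewrite mxE.
  by rewrite bsum betaK mxE.
move=> a s; rewrite (lincomb_finite _ (enK l) (deK l)) bsum /b.
rewrite -[LHS]addr0 -{1}beta0 -betaP addr0; congr beta.
by apply/colP=> j; rewrite -colE !mxE deK.
Qed.

End CellModules.

Lemma sum_count_mem (R : nzSemiRingType) (T : eqType) (x : T) (s : seq T) :
  \sum_(y <- s) (x == y)%:R = (count_mem x s)%:R :> R.
Proof.
rewrite -natr_sum -sum1_count [in RHS]big_mkcond /=; congr (_%:R).
by apply: eq_bigr => y _; rewrite eq_sym; case: eqP.
Qed.

Lemma trace_delta (R : nzRingType) n (i : 'I_n) : \tr (delta_mx i i : 'M[R]_n) = 1.
Proof.
rewrite /mxtrace (bigD1 i) //= mxE eqxx big1 ?addr0 // => j /negPf ji.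
by rewrite mxE ji.
Qed.

Lemma idem_system_bij (K : fieldType) (B : algType K) (I J : finType) (p : I -> B) (s : J -> I) :
  bijective s -> idem_system p -> idem_system (p \o s).
Proof.
move=> [s' sK s'K] [p0 pp pK po [t t1]]; split=> //= [i j b ij|].
  by apply: po; rewrite (can_eq sK).
exists [seq (s' x.1, x.2) | x <- t]; rewrite big_map t1.
by apply: eq_bigr => x _ /=; rewrite s'K.
Qed.

(** * Idempotent systems of the specializations of the algebras [Q n] *)

Section QuotientTower.
Variables (R : idomainType) (d : Order.disp_t) (G : branching_diagram d).
Variables (A Q : tower R) (X : framework G A Q).

Fact level_enum_subproof n : exists E : cell_enum (fw_cellQ X n), True.
Proof.
have [dim [en [de [enK deK]]]] :=
  cell_enumeration (sp_base_change (fw_QF X) n) (fw_QF_split X n) (fw_cellQ X n).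
by exists (CellEnum enK deK).
Qed.

(** The index sets of the cells are numbered once, by means of the fraction field, and the same
    numbering serves for all [K]. *)
Definition level_enum n : cell_enum (fw_cellQ X n) := projT1 (cid (level_enum_subproof n)).

Local Notation dim n := (ce_dim (level_enum n)).
Local Notation en n := (@ce_en _ _ _ _ _ _ (level_enum n)).
Local Notation enK n := (fun l => @ce_enK _ _ _ _ _ _ (level_enum n) l).
Local Notation deK n := (fun l => @ce_deK _ _ _ _ _ _ (level_enum n) l).
Local Notation rep n l := (cell_rep (en n) l).
Local Notation repL S n := (cell_repK (enK n) (deK n) (sp_base_change S n)).

(** The column module of a cell representation is a cell module, so restriction coherence applies to
    it, over [R]. *)
Lemma cell_restriction_chain n (w : G n.+1) : exists ls,
  matrix_chain (fun l => rep n l) (fun a => rep n.+1 w (tw_incl Q n a)) 1%:M ls.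
Proof.
have [M Mw] := @col_module_presented _ _ _ (rep n.+1 w)
  (cell_repP (enK n.+1) (deK n.+1) w) (cell_rep1 (enK n.+1) (deK n.+1) w)
  (cell_repM (enK n.+1) (deK n.+1) w).
have [ls fl] := fw_coherent (presented_cell_module Mw); exists ls.
have {}fl := filtered_mono (@cell_module_presented _ _ _ _ _ _ (level_enum n)) fl.
have [beta [beta_bij betaP]] := Mw.
apply: (filtered_matrix_chain _ _ (M := res M (tw_incl Q n)) (beta := beta)
  _ _ _ _ _ fl) => //.
- exact: cell_rep_scalar.
- by move=> c; rewrite linearZ rmorph1 cell_rep_scalar.
- by move=> x; split=> // _; rewrite mul1mx.
- by rewrite mul1mx.
Qed.

Section Specialized.
Variables (K : fieldType) (rho : {rmorphism R -> K}) (QK : specialization rho Q).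

Lemma cell_matrix_family n : split_semisimple (QK n) -> matrix_family (repL QK n).
Proof.
move=> ss; split.
- exact: cell_repK1.
- exact: cell_repKM.
- exact: cell_repK_inj.
- exact: cell_repK_surj.
Qed.

Lemma cell_restriction_chainK n (w : G n.+1) ls :
  matrix_chain (fun l => rep n l) (fun a => rep n.+1 w (tw_incl Q n a)) 1%:M ls ->
  matrix_chain (repL QK n) (repL QK n.+1 w \o sp_incl QK n) 1%:M ls.
Proof.
move=> ch; rewrite -(map_mx1 rho).
apply: (matrix_chain_base_change (sp_base_change QK n) _ _ ch
  (rK := repL QK n.+1 w \o sp_incl QK n)) => [l a|a].
  by rewrite cell_repK_map.
by rewrite /= sp_incl_map cell_repK_map.
Qed.

End Specialized.

Local Notation toF := (@FracField.tofrac R).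
Local Notation QF := (fw_QF X).
Local Notation repF n := (repL QF n).

(* [tau] matches the labels of fw_QF_branching with the cell labels; fw_QF_branching does not
   relate the two. *)
Lemma cell_labelling : exists tau : forall n, G n -> G n,
  [/\ forall n, injective (tau n), forall n v, (0 < dim n (tau n v))%N
    & forall n w, exists vs,
        matrix_chain (fun v => repF n (tau n v)) (repF n.+1 (tau n.+1 w) \o sp_incl QF n) 1%:M vs /\
        forall v, count_mem v vs = bd_up G (vertex_at v) (vertex_at w)].
Proof.
have [S [S1 S2]] := fw_QF_branching X.
have fam n := cell_matrix_family (fw_QF_split X n).
have ex n v : exists l, (0 < dim n l)%N /\ presented (repF n l) (S n v).
  have [simpleS _ _] := S1 n isT.
  by have [l l0 lS] := simple_presented (fam n) (simpleS v); exists l.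
pose tau n v := projT1 (cid (ex n v)).
have tauP n v : (0 < dim n (tau n v))%N /\ presented (repF n (tau n v)) (S n v).
  by rewrite /tau; case: cid.
exists tau; split=> [n v v' tv|n v|n w].
- have [_ S_inj _] := S1 n isT; apply: S_inj.
  have [_ pv'] := tauP n v'; rewrite -tv in pv'.
  by apply: presented_isomorphic pv'; case: (tauP n v).
- by case: (tauP n v).
have [vs fl cnt] := S2 n isT isT w; exists vs; split=> //.
have {}fl := filtered_mono (fun v N => fun i : isomorphic N (S n v) =>
  isomorphic_presented i (proj2 (tauP n v))) fl.
have [beta [beta_bij betaP]] := proj2 (tauP n.+1 w).
apply: (filtered_matrix_chain _ _ (M := res (S n.+1 w) (sp_incl QF n)) (beta := beta)
  _ _ _ _ _ fl) => //.
- by move=> v c; rewrite linearZ /= cell_repK1 scalemx1.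
- by move=> c; rewrite /= !linearZ /= rmorph1 cell_repK1 scalemx1.
- by move=> a x y; rewrite betaP.
- by move=> x; split=> // _; rewrite mul1mx.
- by rewrite mul1mx.
Qed.

Lemma fraction_natr_inj (m n : nat) : m%:R = n%:R :> {fraction R} -> m = n.
Proof.
rewrite -!(rmorph_nat toF) => /eqP; rewrite tofrac_eq => /eqP mn.
wlog le_mn : m n mn / (m <= n)%N => [th|].
  by case/orP: (leq_total m n) => le; [apply: th | apply/esym/th].
apply/eqP; rewrite eqn_leq le_mn /= -subn_eq0; apply: contraT; rewrite -lt0n => lt_mn.
have [|p] := natf0_pchar lt_mn (R := R); first by rewrite natrB // mn subrr.
by rewrite (fw_char X).
Qed.

Section QuotientSystem.
Variables (K : fieldType) (rho : {rmorphism R -> K}) (QK : specialization rho Q).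

(** A single chain over [R] serves both fields: over the fraction field its multiplicities are
    compared with the edges of the diagram, and over [K] they bound the rank and give the trace of
    an idempotent. *)
Lemma quotient_idem_system (P : pred nat) : (forall n, P n -> split_semisimple (QK n)) ->
  exists q : forall n, G n -> QK n,
    (forall n, P n -> idem_system (q n)) /\
    forall n, P n -> P n.+1 -> forall v w,
      line (sp_incl QK n (q n v)) (q n.+1 w) (bd_up G (vertex_at v) (vertex_at w)).
Proof.
move=> ssQ; have [tau [tau_inj tau_dim tau_chain]] := cell_labelling.
(* An injective self-map of a finite set is onto, so every cell has positive size and a diagonal
   position can be chosen in it. *)
have tau_bij n : bijective (tau n) := injF_bij (@tau_inj n).
have dim_gt0 n l : (0 < dim n l)%N.
  by case: (tau_bij n) => t _ tK; rewrite -[l]tK.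
pose z n l := Ordinal (dim_gt0 n l).
have famF n := cell_matrix_family (fw_QF_split X n).
(* The trace of one idempotent is computed along the specialized chain and along the composition
   series given by the diagram. It counts occurrences in both, and characteristic 0 lets the counts
   be compared. *)
have count_ls n v w ls :
    matrix_chain (fun l => rep n l) (fun a => rep n.+1 (tau n.+1 w) (tw_incl Q n a)) 1%:M ls ->
    count_mem (tau n v) ls = bd_up G (vertex_at v) (vertex_at w).
  move=> /(cell_restriction_chainK QF) chR; have [vs [chF <-]] := tau_chain n w.
  have [p [pP _]] := matrix_family_idem (famF n) (z n).
  have trp l m : \tr (repF n m (p l)) = (l == m)%:R.
    by rewrite pP mxtraceZ trace_delta mulr1.
  have := matrix_chain_trace (p (tau n v)) chR.
  rewrite (matrix_chain_trace (p (tau n v)) chF).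
  under eq_bigr do rewrite trp (inj_eq (@tau_inj n)).
  under [RHS]eq_bigr do rewrite trp.
  by rewrite !sum_count_mem => /fraction_natr_inj.
(* Outside [P] the value is irrelevant, and the zero family fills in. *)
have ex n : exists p : G n -> QK n, P n ->
    (forall l m, repL QK n m (p l) = (l == m)%:R *: delta_mx (z n m) (z n m)) /\ idem_system p.
  case Pn : (P n); last by exists (fun=> 0).
  by have [p pP] := matrix_family_idem (cell_matrix_family (ssQ n Pn)) (z n); exists p.
pose p n := projT1 (cid (ex n)).
have pP n : P n -> (forall l m, repL QK n m (p n l) = (l == m)%:R *: delta_mx (z n m) (z n m)) /\
    idem_system (p n) by rewrite /p; case: cid.
exists (fun n v => p n (tau n v)); split=> [n Pn|n Pn Pn1 v w].
  by apply: (idem_system_bij (tau_bij n)); case: (pP n Pn).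
have [pn sysn] := pP n Pn; have [pn1 _] := pP _ Pn1.
have [ls chR] := cell_restriction_chain (tau n.+1 w).
have ch := cell_restriction_chainK QK chR.
apply: (matrix_family_line (cell_matrix_family (ssQ _ Pn1)) (z := z n.+1) (w := tau n.+1 w)).
- exact: pn1.
(* Each occurrence of the label of [v] adds at most 1 to the rank, and all other labels add 0. *)
- have := matrix_chain_rank (a := p n (tau n v)) ch.
  rewrite mulmx1 /= -cell_repKM -rmorphM idemM // => /(_ erefl) le_rk.
  apply: leq_trans le_rk _; rewrite -(count_ls _ _ _ _ chR) -sum1_count [leqRHS]big_mkcond /=.
  apply: leq_sum => l _; rewrite pn eq_sym; case: eqP => _; last by rewrite scale0r mxrank0.
  by rewrite scale1r mxrank_delta.
- have := matrix_chain_trace (p n (tau n v)) ch; rewrite mulmx1 /= => ->.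
  rewrite -(count_ls _ _ _ _ chR) -sum_count_mem; apply: eq_bigr => l _.
  by rewrite pn mxtraceZ trace_delta mulr1.
Qed.

End QuotientSystem.
End QuotientTower.

(** * The tower of the framework *)

Section JonesTower.
Variables (R : idomainType) (d : Order.disp_t) (G : branching_diagram d).
Variables (A Q : tower R) (X : framework G A Q).
Local Notation j := (tw_emb A).
Local Notation i := (tw_incl A).

(** The idempotent proportional to [e_(n+1)]; the shift skips the meaningless [e_0]. It is locked so
    that simplification does not unfold it. *)
Definition jones_idem n : A n.+2 := locked ((fw_delta X)^-1 *: fw_e X n.+1).

Lemma jones_idemE n : jones_idem n = (fw_delta X)^-1 *: fw_e X n.+1.
Proof. by rewrite /jones_idem -lock. Qed.

Local Notation eb := jones_idem.

Lemma fw_e_jones n : fw_e X n.+1 = fw_delta X *: eb n.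
Proof. by rewrite jones_idemE scalerA mulrV ?scale1r //; apply: fw_delta_unit. Qed.

Lemma emb_jones n : j n.+2 (eb n) = (fw_delta X)^-1 *: fw_ee X n.+1.
Proof. by rewrite jones_idemE linearZ. Qed.

Lemma tower_incl_inj n : injective (i n).
Proof. by move=> x y /(congr1 (j n.+1)); rewrite !tw_emb_incl => /tw_emb_inj. Qed.

Lemma jones_sqr n : eb n * eb n = eb n.
Proof.
rewrite jones_idemE -scalerAl -scalerAr fw_e_sqr // !scalerA -mulrA mulVr ?mulr1 //.
exact: fw_delta_unit.
Qed.

Lemma jones_comm n (x : A n) : eb n * i n.+1 (i n x) = i n.+1 (i n x) * eb n.
Proof.
apply: (tw_emb_inj (t := A)); rewrite !rmorphM /= emb_jones !tw_emb_incl.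
by rewrite -scalerAl -scalerAr fw_e_comm_A.
Qed.

Lemma jones_expectation n (x : A n.+1) :
  eb n * i n.+1 x * eb n = i n.+1 (i n (fw_E X x)) * eb n.
Proof.
rewrite -jones_comm; apply: (tw_emb_inj (t := A)).
by rewrite !rmorphM /= emb_jones !tw_emb_incl; apply: fw_EP.
Qed.

Lemma jones_inj n (x y : A n.+1) : i n.+1 x * eb n = i n.+1 y * eb n -> x = y.
Proof.
move=> /(congr1 (fun z => j n.+2 (fw_delta X *: z))).
rewrite !scalerAr -fw_e_jones !rmorphM /= !tw_emb_incl.
exact: (@fw_Ae_inj _ _ _ _ _ X n.+1).
Qed.

Lemma jones_reduction_ex n (x : A n.+2) : exists y, x * eb n = i n.+1 y * eb n.
Proof.
have [//|y yP] := @fw_Ae _ _ _ _ _ X n.+1 _ x; exists y.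
apply: (tw_emb_inj (t := A)); rewrite !rmorphM /= emb_jones tw_emb_incl.
by rewrite -!scalerAr yP.
Qed.

(** The unique [y] in [A_(n+1)] with [x e = y e]; uniqueness makes it linear in [x], so that it can
    be specialized. *)
Definition jones_reduction n (x : A n.+2) : A n.+1 := projT1 (cid (jones_reduction_ex x)).

Lemma jones_reductionP n (x : A n.+2) : x * eb n = i n.+1 (jones_reduction x) * eb n.
Proof. by rewrite /jones_reduction; case: cid. Qed.

Lemma jones_reduction_linear n : linear (@jones_reduction n).
Proof.
move=> c x y; apply: jones_inj; rewrite -jones_reductionP linearP !mulrDl.
by rewrite -!scalerAl (jones_reductionP x) (jones_reductionP y).
Qed.

Lemma jones_reductionK n (x : A n.+1) : jones_reduction (i n.+1 x * eb n) = x.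
Proof. by apply: jones_inj; rewrite -jones_reductionP -mulrA jones_sqr. Qed.

Lemma fw_E_linear n : linear (@fw_E _ _ _ _ _ X n).
Proof.
move=> c x y; apply: tower_incl_inj; apply: jones_inj; rewrite -jones_expectation.
rewrite !linearP /= mulrDr !mulrDl -!scalerAr -!scalerAl.
by rewrite (jones_expectation x) (jones_expectation y).
Qed.

(** The ideal is spanned by the cells of level below [n+2]. The involution swaps the two indices of
    a cell element up to larger cells, and those are again of low level. *)
Lemma involution_ideal n : two_sided_ideal (fw_e X n.+1) (fw_invA X (fw_e X n.+1)).
Proof.
have [invL invM invK] := fw_invAP X n.+2.
have inv0 : fw_invA X (0 : A n.+2) = 0.
  have h := invL 1 0 0; rewrite scaler0 addr0 scale1r in h.
  by apply: (addrI (fw_invA X (0 : A n.+2))); rewrite -h addr0.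
apply/fw_ideal => //.
have gen := two_sided_ideal_gen (fw_e X n.+1) 1 1; rewrite mulr1 mul1r in gen.
have [u uP eE] := proj1 (@fw_ideal _ _ _ _ _ X n.+1 isT _) gen.
pose bA := cell_elt (@cell_c _ _ _ _ _ (fw_cellA X n.+2)).
pose low := fun x : A n.+2 => cell_span (fw_cellA X n.+2) (reflected_low (n := n.+2)) x.
have low0 : low 0.
  by exists [fsfun] => [y|]; rewrite ?finsupp0 // /lincomb finsupp0 big_nil.
have lowP c x y : low x -> low y -> low (c *: x + y).
  move=> [v vP <-] [v' v'P <-]; have [w [wE wi]] := lincombP bA c v v'.
  exists w => // y'; rewrite mem_finsupp wi => nz.
  have [/vP //|v0] := boolP (y' \in finsupp v).
  apply: v'P; rewrite mem_finsupp; apply: contraNneq nz => ->.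
  by rewrite (fsfun_dflt v0) mulr0 add0r.
rewrite -/(low _) -eE /lincomb.
have : forall k, k \in enum_fset (finsupp u) -> reflected_low (tag k) by [].
elim: (enum_fset (finsupp u)) => [|[l [s t]] ks IH] lowk; first by rewrite big_nil inv0.
have ll : reflected_low l by apply: (lowk (existT _ l (s, t))); rewrite mem_head.
rewrite big_cons invL; apply: (lowP _ _ _); last first.
  by apply: IH => k ks_k; apply: lowk; rewrite inE ks_k orbT.
rewrite /cell_elt /= -[fw_invA _ _](subrK (cell_c t s)) -[_ - _]scale1r; apply: (lowP _ _ _).
  have [v vP vE] := cell_inv (c := fw_cellA X n.+2) s t; exists v => // k /vP.
  rewrite lt_neqAle => /andP[_ /orP[|/andP[/eqP e _]]]; rewrite /reflected_low.
    by move=> /ltn_trans; apply.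
  by rewrite -e.
have [v [vE v_delta]] := lincomb_delta bA (existT _ l (t, s)).
exists v => // k; rewrite mem_finsupp v_delta; case: (eqVneq k) => [->|] //.
by rewrite eqxx.
Qed.

End JonesTower.

(** * Specialization of the idempotents, expectations, traces and quotient maps *)

Section SpecializedJonesTower.
Variables (R : idomainType) (d : Order.disp_t) (G : branching_diagram d).
Variables (A Q : tower R) (X : framework G A Q).
Variables (K : fieldType) (rho : {rmorphism R -> K}).
Variables (AK : specialization rho A) (QK : specialization rho Q).
Variable trK : forall n, {scalar AK n}.
Hypothesis trKP : specialized_trace (fw_tr X) trK.

Local Notation phi n := (sp_map AK n).
Local Notation f n := (sp_incl AK n).
Local Notation bc n := (sp_base_change AK n).
Local Notation ebK n := (phi n.+2 (jones_idem X n)).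

Lemma sp_mapP (T : tower R) (S : specialization rho T) n c x y :
  sp_map S n (c *: x + y) = rho c *: sp_map S n x + sp_map S n y.
Proof. by rewrite rmorphD (base_changeZ (sp_base_change S n)). Qed.

Lemma jones_sqrK n : ebK n * ebK n = ebK n.
Proof. by rewrite -rmorphM jones_sqr. Qed.

Lemma jones_commK n x : ebK n * f n.+1 (f n x) = f n.+1 (f n x) * ebK n.
Proof.
move: x; apply: (base_change_ext (bc n)) => [c x y|c x y|x].
- by rewrite !linearP /= mulrDr -scalerAr.
- by rewrite !linearP /= mulrDl -scalerAl.
- by rewrite !sp_incl_map -!rmorphM jones_comm.
Qed.

Fact expectationK_ex n : exists E : {linear AK n.+1 -> AK n},
  forall x, E (phi n.+1 x) = phi n (fw_E X x).
Proof.
apply: (base_change_fun (bc n.+1)) => r x y.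
by rewrite fw_E_linear sp_mapP.
Qed.

Definition expectationK n := projT1 (cid (expectationK_ex n)).

Lemma expectationK_map n x : expectationK n (phi n.+1 x) = phi n (fw_E X x).
Proof. by rewrite /expectationK; case: cid. Qed.

Lemma jones_expectationK n x :
  ebK n * f n.+1 x * ebK n = f n.+1 (f n (expectationK n x)) * ebK n.
Proof.
move: x; apply: (base_change_ext (bc n.+1)) => [c x y|c x y|x].
- by rewrite !linearP /= mulrDr mulrDl -scalerAr -scalerAl.
- by rewrite !linearP /= mulrDl -scalerAl.
- by rewrite expectationK_map !sp_incl_map -!rmorphM jones_expectation.
Qed.

Fact reductionK_ex n : exists r : {linear AK n.+2 -> AK n.+1},
  forall x, r (phi n.+2 x) = phi n.+1 (jones_reduction X x).
Proof.
apply: (base_change_fun (bc n.+2)) => r x y.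
by rewrite jones_reduction_linear sp_mapP.
Qed.

Definition reductionK n := projT1 (cid (reductionK_ex n)).

Lemma reductionK_map n x : reductionK n (phi n.+2 x) = phi n.+1 (jones_reduction X x).
Proof. by rewrite /reductionK; case: cid. Qed.

Lemma reductionKP n b : b * ebK n = f n.+1 (reductionK n b) * ebK n.
Proof.
move: b; apply: (base_change_ext (bc n.+2)) => [c x y|c x y|x].
- by rewrite mulrDl -scalerAl.
- by rewrite !linearP /= mulrDl -scalerAl.
- by rewrite reductionK_map sp_incl_map -!rmorphM -jones_reductionP.
Qed.

(** Injectivity by itself need not survive specialization, but the linear left inverse given by the
    reduction map does. *)
Lemma jones_injK n x : f n.+1 x * ebK n = 0 -> x = 0.
Proof.
move=> x0; have <- : reductionK n (f n.+1 x * ebK n) = x; last by rewrite x0 linear0.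
move: x {x0}; apply: (base_change_ext (bc n.+1)) => [c x y|c x y|x] //.
  by rewrite linearP mulrDl -scalerAl linearP.
by rewrite sp_incl_map -rmorphM reductionK_map jones_reductionK.
Qed.

Lemma base_scalar (x : AK 0) : exists c, x = c *: 1.
Proof.
have [g gK Kg] := fw_A0 X; have {}Kg a : (g a)%:A = a by exact: Kg.
have [r x' y'|h hP] := base_change_fun (bc 0) (V := K^o) (f := fun a => rho (g a)).
  have -> : g (r *: x' + y') = r * g x' + g y'; last by rewrite rmorphD rmorphM.
  by apply: (can_inj gK); rewrite /= Kg scalerDl -scalerA !Kg.
exists (h x); move: x; apply: (base_change_ext (bc 0)) => [c x y //|c x y|a].
  by rewrite linearP scalerDl -scalerA.
by rewrite hP -{1}[a]Kg (base_changeZ (bc 0)) rmorph1.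
Qed.

(** For positive levels multiply by the idempotent; at level 0 the algebra consists of scalars,
    which act faithfully on a nonzero unit. *)
Lemma sp_incl_inj n x : f n x = 0 -> x = 0.
Proof.
case: n x => [|n] x fx; last by apply: (@jones_injK n); rewrite fx mul0r.
have [c xc] := base_scalar x; rewrite xc in fx *; move: fx.
by rewrite linearZ rmorph1 => /eqP; rewrite scaler_eq0 oner_eq0 orbF => /eqP ->; rewrite scale0r.
Qed.

Lemma trKC n x y : trK n (x * y) = trK n (y * x).
Proof.
move: x; apply: (@base_change_ext _ _ _ _ _ _ (bc n) K^o) => [c x x'|c x x'|x].
- by rewrite mulrDl -scalerAl linearP.
- by rewrite mulrDr -scalerAr linearP.
move: y; apply: (@base_change_ext _ _ _ _ _ _ (bc n) K^o) => [c x' y|c x' y|y].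
- by rewrite mulrDr -scalerAr linearP.
- by rewrite mulrDl -scalerAl linearP.
by rewrite -!rmorphM !trKP fw_trC.
Qed.

Lemma trK_expectation n x : trK n.+1 x = trK n (expectationK n x).
Proof.
move: x; apply: (@base_change_ext _ _ _ _ _ _ (bc n.+1) K^o) => [c x y|c x y|x].
- by rewrite linearP.
- by rewrite !linearP.
by rewrite expectationK_map !trKP fw_tr_E.
Qed.

Lemma involutionK n : exists inv : AK n.+2 -> AK n.+2,
  [/\ forall x y, inv (x + y) = inv x + inv y, forall x y, inv (x * y) = inv y * inv x,
      involutive inv & two_sided_ideal (ebK n) (inv (ebK n))].
Proof.
have [invL invM invK] := fw_invAP X n.+2.
have [r x y|inv invP] := base_change_fun (bc n.+2) (f := fun a => phi n.+2 (fw_invA X a)).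
  by rewrite invL sp_mapP.
exists inv; split=> [x y|x y|x|].
- exact: linearD.
- move: x; apply: (base_change_ext (bc n.+2)) => [c x x'|c x x'|x].
  + by rewrite mulrDl -scalerAl linearP.
  + by rewrite linearP mulrDr -scalerAr.
  move: y; apply: (base_change_ext (bc n.+2)) => [c x' y|c x' y|y].
  + by rewrite mulrDr -scalerAr linearP.
  + by rewrite linearP mulrDl -scalerAl.
  by rewrite -rmorphM !invP invM rmorphM.
- move: x; apply: (base_change_ext (bc n.+2)) => [c x y|c x y //|x].
  + by rewrite !linearP.
  by rewrite !invP invK.
have [s sE] := involution_ideal X n.
have inv0 : fw_invA X (0 : A n.+2) = 0.
  by apply: add_self0; have := invL 1 0 0; rewrite scaler0 addr0 scale1r.
exists [seq (phi n.+2 t.1, phi n.+2 t.2) | t <- s]; rewrite big_map invP.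
have -> : fw_invA X (jones_idem X n) = \sum_(t <- s) t.1 * jones_idem X n * t.2.
  rewrite {1}jones_idemE -[Y in fw_invA X Y = _]addr0 invL inv0 addr0 sE scaler_sumr.
  by apply: eq_bigr => t _; rewrite jones_idemE -scalerAr scalerAl.
by rewrite rmorph_sum; apply: eq_bigr => t _ /=; rewrite !rmorphM.
Qed.

Fact piK_ex n : exists p : {lrmorphism AK n -> QK n},
  forall x, p (phi n x) = sp_map QK n (fw_pi X n x).
Proof.
have [r x y|g gP] := base_change_fun (bc n) (f := fun a => sp_map QK n (fw_pi X n a)).
  by rewrite linearP sp_mapP.
have [||p pE] := base_change_lrmorphism (bc n) (f := g).
- by rewrite -(rmorph1 (phi n)) gP !rmorph1.
- by move=> x y; rewrite -rmorphM !gP !rmorphM.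
by exists p => x; rewrite pE.
Qed.

Definition piK n := projT1 (cid (piK_ex n)).

Lemma piK_map n x : piK n (phi n x) = sp_map QK n (fw_pi X n x).
Proof. by rewrite /piK; case: cid. Qed.

Lemma piK_incl n x : piK n.+1 (f n x) = sp_incl QK n (piK n x).
Proof.
move: x; apply: (base_change_ext (bc n)) => [c x y|c x y|x].
- by rewrite !linearP.
- by rewrite !linearP.
by rewrite sp_incl_map !piK_map sp_incl_map fw_pi_incl.
Qed.

Lemma piK_ext n (V : lmodType K) (g g' : {linear QK n -> V}) :
  (forall b, g (piK n b) = g' (piK n b)) -> g =1 g'.
Proof.
move=> gg'; apply: (base_change_ext (sp_base_change QK n)) => [c x y|c x y|y].
- by rewrite linearP.
- by rewrite linearP.
by have [x <-] := fw_pi_surj X y; rewrite -piK_map.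
Qed.

(** Right exactness of base change: the specialized projection is still a quotient map. The choice
    of lifts is harmless, as [h] kills the kernel. *)
Lemma piK_factor n (V : lmodType K) (h : {linear AK n -> V}) :
    (forall x, fw_pi X n x = 0 -> h (phi n x) = 0) ->
  exists s : {linear QK n -> V}, forall b, s (piK n b) = h b.
Proof.
move=> h0; have [lift liftK] := choice (@fw_pi_surj _ _ _ _ _ X n).
have h_pi x y : fw_pi X n x = fw_pi X n y -> h (phi n x) = h (phi n y).
  move=> xy; apply/eqP; rewrite -subr_eq0 -linearB -rmorphB; apply/eqP/h0.
  by rewrite linearB /= xy subrr.
have [r x y|s sP] := base_change_fun (sp_base_change QK n) (f := fun y => h (phi n (lift y))).
  rewrite -linearP -sp_mapP; apply: h_pi.
  by rewrite linearP /= !liftK.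
exists s; apply: (base_change_ext (bc n)) => [c x y|c x y|x].
- by rewrite !linearP.
- by rewrite linearP.
by rewrite piK_map sP; apply: h_pi.
Qed.

Lemma piK_jones n : piK n.+2 (ebK n) = 0.
Proof.
rewrite piK_map jones_idemE linearZ /=; have -> : fw_pi X n.+2 (fw_e X n.+1) = 0.
  apply/(@fw_pi_ker _ _ _ _ _ X n.+1 isT).
  by have := two_sided_ideal_gen (fw_e X n.+1) 1 1; rewrite mul1r mulr1.
by rewrite scaler0 rmorph0.
Qed.

Lemma piK_factor_jones n (h : {linear AK n.+2 -> AK n.+2}) :
    (forall b, two_sided_ideal (ebK n) b -> h b = 0) ->
  exists s : {linear QK n.+2 -> AK n.+2}, forall b, s (piK n.+2 b) = h b.
Proof.
move=> h0; apply: piK_factor => x /(@fw_pi_ker _ _ _ _ _ X n.+1 isT) [s ->].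
apply: h0; rewrite rmorph_sum; apply: two_sided_ideal_sum => t.
rewrite fw_e_jones -scalerAr -scalerAl (base_changeZ (bc n.+2)) !rmorphM.
have -> : rho (fw_delta X) *: (phi n.+2 t.1 * ebK n * phi n.+2 t.2) =
  (rho (fw_delta X) *: phi n.+2 t.1) * ebK n * phi n.+2 t.2 by rewrite !scalerAl.
exact: two_sided_ideal_gen.
Qed.

End SpecializedJonesTower.

(** The construction of a level uses the two preceding levels and the relation between them, so
    related pairs are iterated. *)
Lemma dependent_choice2 (T : nat -> Type) (R : forall n, T n -> T n.+1 -> Prop)
    (x0 : T 0) (x1 : T 1) :
    R 0 x0 x1 -> (forall n a b, R n a b -> exists c, R n.+1 b c) ->
  exists f : forall n, T n, f 0 = x0 /\ forall n, R n (f n) (f n.+1).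
Proof.
move=> R0 step.
pose S n := {ab : T n * T n.+1 | R n ab.1 ab.2}.
pose next n (s : S n) : S n.+1 :=
  let c := cid (step n _ _ (svalP s)) in exist _ ((sval s).2, projT1 c) (projT2 c).
pose g := fix g n : S n := if n is m.+1 then next m (g m) else exist _ (x0, x1) R0.
exists (fun n => (sval (g n)).1); split=> // n.
exact: svalP (g n).
Qed.

Lemma odd_subSS n k : (k <= n)%N -> odd (n.+2 - k) = odd (n - k).
Proof. by move=> kn; rewrite -addn2 -addnBAC // oddD addbF. Qed.

(** * Vertices of the reflected diagram *)

Section Labels.
Variables (d : Order.disp_t) (G : branching_diagram d).

Lemma reflected_ex n k (g : G k) : (k <= n)%N -> ~~ odd (n - k) ->
  exists v : reflected G n, under v = vertex_at g.
Proof.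
rewrite -ltnS => kn odd_nk.
by exists (exist _ (existT (fun k : 'I_n.+1 => G k) (Ordinal kn) g) odd_nk).
Qed.

Lemma under_level n (v : reflected G n) : (tag (under v) <= n)%N.
Proof. by rewrite -ltnS; apply: ltn_ord. Qed.

Lemma under_parity n (v : reflected G n) : ~~ odd (n - tag (under v)).
Proof. exact: valP v. Qed.

Lemma vertex_at_inj k : injective (@vertex_at _ G k).
Proof. by move=> a b ab; apply: (eq_from_Tagged ab). Qed.

Lemma vertexE (v : vertex G) k : tag v = k -> exists g : G k, v = vertex_at g.
Proof. by case: v => l g /= <-; exists g. Qed.

(** Parity excludes level [n+1], so a vertex at level [n+2] either repeats one of level [n] or is
    new in [G]. This matches the splitting of the algebra into the ideal and the quotient. *)
Lemma reflected_split n : exists s : reflected G n.+2 -> reflected G n + G n.+2,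
  bijective s /\ forall v, under v = match s v with inl u => under u | inr g => vertex_at g end.
Proof.
have ex (x : reflected G n + G n.+2) : exists v : reflected G n.+2,
    under v = match x with inl u => under u | inr g => vertex_at g end.
  case: x => [u|g]; last by apply: reflected_ex; rewrite ?subnn.
  have [w uw] := vertexE (erefl (tag (under u))).
  rewrite uw; apply: reflected_ex; first by rewrite (leq_trans (under_level u)) // -addn2 leq_addr.
  by rewrite odd_subSS ?under_level ?under_parity.
have [t tP] := choice ex.
have sur (v : reflected G n.+2) : exists x, t x = v.
  have [w vw] := vertexE (erefl (tag (under v))).
  have [e|ne] := eqVneq (tag (under v)) n.+2.
    have [g vg] := vertexE e; exists (inr g); apply: under_inj.
    by rewrite tP vg.
  have le_vn : (tag (under v) <= n)%N.
    have := under_level v; rewrite leq_eqVlt (negPf ne) orFb ltnS leq_eqVlt.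
    by case/predU1P=> [e|//]; have := under_parity v; rewrite e subSnn.
  have [|u uP] := reflected_ex w le_vn.
    by rewrite -odd_subSS // under_parity.
  by exists (inl u); apply: under_inj; rewrite tP uP -vw.
have [s sP] := choice sur; exists s; split; last by move=> v; rewrite -{1}(sP v) tP.
exists t => // x; suff inj y : under (t y) = under (t x) -> y = x by apply: inj; rewrite sP.
rewrite !tP; case: y x => [u|g] [u'|g'].
- by move/under_inj->.
- move=> /(congr1 (@tag _ _)) e; have : (n.+2 <= n)%N by have := under_level u; rewrite e.
  by rewrite ltnNge leqnSn.
- move=> /(congr1 (@tag _ _)) e; have : (n.+2 <= n)%N by have := under_level u'; rewrite -e.
  by rewrite ltnNge leqnSn.
- by move/vertex_at_inj->.
Qed.

Lemma reflected_small n : (n <= 1)%N -> exists s : reflected G n -> G n,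
  bijective s /\ forall v, under v = vertex_at (s v).
Proof.
move=> n1.
have lev (v : reflected G n) : tag (under v) = n.
  have := under_parity v; have := under_level v.
  by case: n n1 v => [|[|//]] _ v; case: (tag (under v)) => [|[|]].
have ex (v : reflected G n) : exists g : G n, under v = vertex_at g := vertexE (lev v).
have [s sP] := choice ex; exists s; split=> //.
have ex' (g : G n) : exists v : reflected G n, under v = vertex_at g.
  by apply: reflected_ex; rewrite ?subnn.
have [t tP] := choice ex'; exists t => [v|g].
  by apply: under_inj; rewrite tP.
by apply: vertex_at_inj; rewrite -sP tP.
Qed.

End Labels.

Section IsomorphicSystems.
Variables (K : fieldType) (B C : algType K) (g : {lrmorphism B -> C}).
Hypothesis g_bij : bijective g.

Lemma idem_system_iso (I : finType) (p : I -> B) :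
  idem_system (g \o p) -> idem_system p.
Proof.
have gI := bij_inj g_bij; have [h gK hK] := g_bij.
move=> [p0 pp pK po [s s1]]; split=> [i|i|i b|i j b ij|].
- by apply: contra_neq (p0 i) => /= ->; rewrite rmorph0.
- by apply: gI; rewrite rmorphM; apply: pp.
- by have [c cP] := pK i (g b); exists c; apply: gI; rewrite !rmorphM linearZ; apply: cP.
- by apply: gI; rewrite !rmorphM rmorph0; apply: po.
exists [seq (t.1, (h t.2.1, h t.2.2)) | t <- s].
rewrite big_map; apply: gI; rewrite rmorph1 s1 rmorph_sum; apply: eq_bigr => t _ /=.
by rewrite !rmorphM /= !hK.
Qed.

Lemma line_iso (p q : B) e : line (g p) (g q) e -> line p q e.
Proof.
have gI := bij_inj g_bij; have [h gK hK] := g_bij.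
case: e => /= [[w [w0 wP wL]]|pq b]; last by apply: gI; rewrite !rmorphM rmorph0; apply: pq.
exists (h w); split=> [||b].
- by apply: contra_neq w0 => hw; rewrite -[w]hK hw rmorph0.
- by apply: gI; rewrite !rmorphM /= hK.
- by have [c cP] := wL (g b); exists c; apply: gI; rewrite !rmorphM linearZ /= hK; apply: cP.
Qed.

End IsomorphicSystems.

(** * Inductive construction of the systems *)

Section MainStep.
Variables (R : idomainType) (d : Order.disp_t) (G : branching_diagram d).
Variables (A Q : tower R) (X : framework G A Q).
Variables (K : fieldType) (rho : {rmorphism R -> K}).
Variables (AK : specialization rho A) (QK : specialization rho Q).
Variable trK : forall n, {scalar AK n}.
Hypothesis trKP : specialized_trace (fw_tr X) trK.
Local Notation pi n := (piK X AK QK n).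

(** With trivial kernel the identity factors through the projection, which provides its inverse. *)
Lemma piK_bij n : injective (@fw_pi _ _ _ _ _ X n) -> bijective (pi n).
Proof.
move=> inj; have [|s sP] := @piK_factor _ _ _ _ _ X _ _ AK QK n (AK n) idfun.
  by move=> x x0 /=; rewrite (_ : x = 0) ?rmorph0 //; apply: inj; rewrite x0 rmorph0.
exists s => // c.
exact: (@piK_ext _ _ _ _ _ X _ _ AK QK n (QK n) (pi n \o s) idfun (fun b => congr1 (pi n) (sP b))).
Qed.

Lemma fw_pi_small n : (n <= 1)%N -> injective (@fw_pi _ _ _ _ _ X n).
Proof.
case: n => [|[|//]] _; last exact: bij_inj (fw_A1 X).
have [g gK Kg] := fw_A0 X; have [h hK _] := fw_Q0 X.
move=> x y; rewrite -[x]Kg -[y]Kg /= !linearZ /= !rmorph1 => e.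
congr (_%:A); apply: (can_inj hK); exact: e.
Qed.

Variable q : forall n, G n -> QK n.

(** The invariant of the induction: idempotents of vertices of full level [n] lift the system [q] of
    the quotient, and the others vanish in the quotient. It controls the lines towards the next
    quotient. *)
Definition valid_system n (p : reflected G n -> AK n) : Prop :=
  [/\ idem_system p, forall v y, under v = vertex_at y -> pi n (p v) = q y
    & forall v, (tag (under v) < n)%N -> pi n (p v) = 0].

Lemma bd_up_false (v w : vertex G) : tag w != (tag v).+1 -> bd_up G v w = false.
Proof. by move=> vw; apply: contraNF vw => /bd_up_level ->. Qed.

Lemma small_system n : (n <= 1)%N -> idem_system (q (n := n)) -> exists p, valid_system (n := n) p.
Proof.
move=> n1 sysq; have [s [s_bij sP]] := reflected_small G n1.
have pi_bij := piK_bij (fw_pi_small n1); have [h piK' hK] := pi_bij.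
exists (fun v => h (q (s v))); split=> [|v y|v vn].
- apply: (idem_system_iso pi_bij).
  have -> : pi n \o (fun v => h (q (s v))) = q (n := n) \o s.
    by apply/funext => v /=; rewrite hK.
  exact: idem_system_bij s_bij sysq.
- by rewrite hK sP => /vertex_at_inj ->.
- by move: vn; rewrite sP ltnn.
Qed.

Lemma small_line (p0 : reflected G 0 -> AK 0) (p1 : reflected G 1 -> AK 1) :
    valid_system p0 -> valid_system p1 ->
    (forall v w, line (sp_incl QK 0 (q v)) (q w) (bd_up G (vertex_at v) (vertex_at w))) ->
  forall v w, line (sp_incl AK 0 (p0 v)) (p1 w) (reflected_up v w).
Proof.
move=> [_ piq0 _] [_ piq1 _] lineq v w.
have [s0 [_ s0P]] := reflected_small G (isT : 0 <= 1)%N.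
have [s1 [_ s1P]] := reflected_small G (isT : 1 <= 1)%N.
apply: (line_iso (piK_bij (fw_pi_small (isT : 1 <= 1)%N))).
rewrite piK_incl (piq0 _ _ (s0P v)) (piq1 _ _ (s1P w)).
by rewrite /reflected_up s0P s1P [X in _ || X]bd_up_false // orbF.
Qed.

Lemma system_step n (p0 : reflected G n -> AK n) (p1 : reflected G n.+1 -> AK n.+1) :
    ~ degenerate (trK n.+1) -> valid_system p0 -> valid_system p1 ->
    (forall v w, line (sp_incl AK n (p0 v)) (p1 w) (reflected_up v w)) ->
    idem_system (q (n := n.+2)) ->
    (forall v w, line (sp_incl QK n.+1 (q v)) (q w) (bd_up G (vertex_at v) (vertex_at w))) ->
  exists p2 : reflected G n.+2 -> AK n.+2, valid_system p2 /\
    forall v w, line (sp_incl AK n.+1 (p1 v)) (p2 w) (reflected_up v w).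
Proof.
move=> ndeg [sys0 _ _] [sys1 piq pi0] line01 sysq lineq.
have tr_nondeg x : x != 0 -> exists y, trK n.+1 (x * y) != 0.
  move=> x0; apply: contrapT => h; apply: ndeg; exists x; split=> // y.
  by apply/eqP/negPn/negP => xy; apply: h; exists y.
have [inv [invD invM invK inv_e]] := involutionK X AK n.
have tr_E x : expectationK X AK n x = 0 -> trK n.+1 x = 0.
  by move=> Ex; rewrite (trK_expectation trKP) Ex linear0.
(* Only vertices of full level [n+1] can have an edge to [G n.+2]; for the others both the line and
   the edge relation are trivial. *)
have lineDQ v w : line (sp_incl QK n.+1 (pi n.+1 (p1 v))) (q w) (bd_up G (under v) (vertex_at w)).
  have := under_level v; rewrite leq_eqVlt => /predU1P[e|lt_vn].
    have [g vg] := vertexE e; rewrite (piq _ _ vg) vg; exact: lineq.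
  rewrite (pi0 _ lt_vn) rmorph0 bd_up_false => [b|]; first by rewrite !mul0r.
  by rewrite /= eqSS gtn_eqF.
have [p [sysp lineJ lineQ pJ pQ]] := basic_construction (jones_sqrK X AK n)
  (@jones_commK _ _ _ _ _ X _ _ AK n) (@jones_expectationK _ _ _ _ _ X _ _ AK n)
  (@reductionKP _ _ _ _ _ X _ _ AK n) (@jones_injK _ _ _ _ _ X _ _ AK n)
  (@sp_incl_inj _ _ _ _ _ X _ _ AK n) (@trKC _ _ _ _ _ _ _ _ _ _ trKP n.+1)
  tr_nondeg tr_E invD invM invK inv_e sys0 sys1 line01
  (@piK_incl _ _ _ _ _ X _ _ AK QK n.+1) (piK_jones X AK QK n)
  (@piK_factor_jones _ _ _ _ _ X _ _ AK QK n)
  (fun g g' => @piK_ext _ _ _ _ _ X _ _ AK QK n.+2 _ g g') sysq lineDQ.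
have [s [s_bij sP]] := reflected_split G n; exists (p \o s); split; first split.
- exact: idem_system_bij s_bij sysp.
- move=> v y; rewrite sP /=; case: (s v) => [u e|g /vertex_at_inj ->]; last exact: pQ.
  by have : (n.+2 <= n)%N by [have := under_level u; rewrite e]; rewrite ltnNge leqnSn.
- move=> v; rewrite sP /=; case: (s v) => [u _|g]; first exact: pJ.
  by rewrite ltnn.
(* A repeated vertex has the reversed edges of the previous step; for a new vertex the levels leave
   only the upward edges of [G]. *)
- move=> v w; rewrite /reflected_up (sP w) /=; case: (s w) => [u|g].
    by rewrite orbC; apply: lineJ.
  rewrite (bd_up_false (v := vertex_at g)) ?orbF; first exact: lineQ.
  by rewrite /= ltn_eqF // ltnS (leq_trans (under_level v)) // leqW.
Qed.

End MainStep.

Theorem theorem3p7 (R : idomainType) (d : Order.disp_t)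
    (G : branching_diagram d) (G_infinite : bd_infinite G)
    (A Q : tower R) (X : framework G A Q)
    (K : fieldType) (rho : {rmorphism R -> K})
    (AK : specialization rho A) (QK : specialization rho Q)
    (trK : forall n, {scalar AK n})
    (trKP : specialized_trace (fw_tr X) trK)
    (n0 n1 : option nat)
    (n0P : smallest (fun n => degenerate (trK n)) n0)
    (n1P : smallest (fun n => ~ semisimple (QK n)) (omap succn n1)) :
  let m := omin n0 n1 in
  (forall k, ole k m -> split_semisimple (AK k)) /\
  has_branching_diagram (sp_incl AK) (fun k => ole k m)
    (fun n => reflected G n) (fun n v w => reflected_up v w).
Proof.
move=> m.
(* The inequality is strict here: level [k+1] is built from a nondegenerate trace on level [k],
   while at level [n0] itself the trace may be degenerate. *)
have m_n0 k : ole k.+1 m -> ~ degenerate (trK k).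
  rewrite /m; case: n0 n0P n1 {n1P m} => [a [_ lt_a]|h] [b|] /=; try by move=> _; apply: h.
    by rewrite leq_min => /andP[ka _]; apply: lt_a.
  exact: lt_a.
have m_n1 k : ole k m -> ole k n1.
  by rewrite /m; case: n0 n1 {n0P n1P m m_n0} => [a|] [b|] //=; rewrite leq_min => /andP[].
have mS k : ole k.+1 m -> ole k m by case: m {m_n0 m_n1} => //= a; apply: ltnW.
(* In the second alternative of the axiom, a level [k] beyond its threshold [b] would be
   non-semisimple, against the minimality of [n1 + 1]. *)
have ssQ k : ole k n1 -> split_semisimple (QK k).
  move=> kn1; case: (fw_QK X QK) => [//|[b [ssb nssb]]].
  have [/ssb//|bk] := leqP k b; exfalso.
  case: n1 n1P kn1 {m m_n0 m_n1 mS} => [c|] /= h kc.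
    by case: h => _ /(_ k kc); apply; apply: nssb.
  by apply: (h k); apply: nssb.
have [q [sysq lineq]] := quotient_idem_system X ssQ.
pose T n := reflected G n -> AK n.
pose val n (p : T n) := valid_system X q p.
(* The condition is imposed only up to level [m], so that the sequence can be continued by zero
   families beyond it. *)
pose Rel n (a : T n) (b : T n.+1) := ole n.+1 m ->
  [/\ val n a, val n.+1 b & forall v w, line (sp_incl AK n (a v)) (b w) (reflected_up v w)].
have [p0 p0P] : exists p : T 0, val 0 p.
  by apply: small_system => //; apply: sysq; rewrite /ole; case: (n1).
have [p1 R01] : exists p1, Rel 0 p0 p1.
  have [m1|] := EM (ole 1 m); last by exists (fun=> 0).
  have sys1 := sysq 1 (m_n1 _ m1).
  have [p1 p1P] := small_system X AK (q := q) (isT : 1 <= 1)%N sys1; exists p1 => _; split=> //.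
  by apply: small_line p0P p1P _; apply: lineq; apply: m_n1 => //; apply: mS.
have step n a b : Rel n a b -> exists c, Rel n.+1 b c.
  move=> Rab; have [m2|] := EM (ole n.+2 m); last by exists (fun=> 0).
  have [va vb ab] := Rab (mS _ m2).
  have [c [vc bc]] := system_step trKP (m_n0 _ m2) va vb ab (sysq _ (m_n1 _ m2))
    (lineq _ (m_n1 _ (mS _ m2)) (m_n1 _ m2)).
  by exists c => _; split.
have [p [pE pR]] := dependent_choice2 R01 step.
have sysp k : ole k m -> idem_system (p k).
  case: k => [_|k km]; first by rewrite pE; case: p0P.
  by have [_ []] := pR k km.
split=> [k /sysp|]; first exact: idem_system_split.
apply: (idem_system_branching sysp) => k _ k1.
by have [] := pR k k1.
Qed.
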